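(* There exist finite-dimensional real nilpotent Lie algebras $\mathfrak{g}$ and $\mathfrak{h}$ such that the associated Carnot graded Lie algebras $\operatorname{Car}(\mathfrak{g})$ and $\operatorname{Car}(\mathfrak{h})$ are isomorphic as Lie algebras, the real cohomology algebras $H^*(\mathfrak{g};\mathbb{R})$ and $H^*(\mathfrak{h};\mathbb{R})$ are isomorphic as graded algebras, but $\mathfrak{g}$ and $\mathfrak{h}$ are not isomorphic as Lie algebras.
   Context: For a nilpotent Lie algebra $\mathfrak{g}$, the lower central series is $\mathfrak{g}^{(0)}=\mathfrak{g}$, $\mathfrak{g}^{(i)}=[\mathfrak{g}^{(i-1)},\mathfrak{g}]$ for $i\ge 1$, and the associated Carnot graded Lie algebra is $\operatorname{Car}(\mathfrak{g})=\bigoplus_{i\ge 0}\mathfrak{g}^{(i)}/\mathfrak{g}^{(i+1)}$ with the induced Lie bracket. $H^*(\mathfrak{g};\mathbb{R})$ denotes Lie algebra cohomology with trivial real coefficients (the cohomology of the Chevalley–Eilenberg algebra $(\Lambda\mathfrak{g}^*,\mathrm{d})$), a graded algebra under the cup product. *)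

(* Defs.v *)
From HB Require Import structures.
From mathcomp Require Import all_boot all_order all_algebra.
From mathcomp Require Import generic_quotient ring_quotient.
From mathcomp Require Import zify ring.
From mathcomp Require Import boolp functions reals.

Set Implicit Arguments.
Unset Strict Implicit.
Unset Printing Implicit Defensive.

Import GRing.Theory.
Local Open Scope ring_scope.
Local Open Scope quotient_scope.

HB.mixin Record Lmodule_isLie (K : fieldType) L of GRing.Lmodule K L := {
  lie : L -> L -> L;
  lie_linearl : forall z, linear (lie^~ z);
  lie_linearr : forall z, linear (lie z);
  liexx : forall x, lie x x = 0;
  lie_jacobi : forall x y z,
    lie x (lie y z) + lie y (lie z x) + lie z (lie x y) = 0
}.

#[short(type="lieAlgType")]
HB.structure Definition LieAlgebra (K : fieldType) :=
  {L of GRing.Lmodule K L & Lmodule_isLie K L}.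

#[short(type="finLieAlgType")]
HB.structure Definition FinLieAlgebra (K : fieldType) :=
  {L of Vector K L & Lmodule_isLie K L}.

Definition lie_isomorphic (K : fieldType) (g h : lieAlgType K) : Prop :=
  exists f : {linear g -> h},
    bijective f /\ forall x y, f (lie x y) = lie (f x) (f y).

Section LieTheory.
Variables (K : fieldType) (g : lieAlgType K).
Implicit Types x y z : g.

HB.instance Definition _ z :=
  GRing.isLinear.Build K g g *:%R (lie z) (lie_linearr z).

Lemma lieDl x y z : lie (x + y) z = lie x z + lie y z.
Proof. by have := @lie_linearl K g z 1 x y; rewrite !scale1r. Qed.
Lemma lieDr x y z : lie z (x + y) = lie z x + lie z y.
Proof. by have := @lie_linearr K g z 1 x y; rewrite !scale1r. Qed.
Lemma lie0l x : lie 0 x = 0.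
Proof. by apply: (addIr (lie 0 x)); rewrite -lieDl !add0r. Qed.
Lemma lie0r x : lie x 0 = 0.
Proof. by apply: (addIr (lie x 0)); rewrite -lieDr !add0r. Qed.
Lemma lieZl a x z : lie (a *: x) z = a *: lie x z.
Proof. by have := @lie_linearl K g z a x 0; rewrite !addr0 lie0l addr0. Qed.
Lemma lieZr a x z : lie z (a *: x) = a *: lie z x.
Proof. by have := @lie_linearr K g z a x 0; rewrite !addr0 lie0r addr0. Qed.
Lemma lieNl x z : lie (- x) z = - lie x z.
Proof. by rewrite -scaleN1r lieZl scaleN1r. Qed.
Lemma lieNr x z : lie z (- x) = - lie z x.
Proof. by rewrite -scaleN1r lieZr scaleN1r. Qed.
Lemma lieBl x y z : lie (x - y) z = lie x z - lie y z.
Proof. by rewrite lieDl lieNl. Qed.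
Lemma lieBr x y z : lie z (x - y) = lie z x - lie z y.
Proof. by rewrite lieDr lieNr. Qed.
Lemma lie_antisym x y : lie x y = - lie y x.
Proof.
apply/eqP; rewrite -addr_eq0; apply/eqP.
by have := liexx (x + y); rewrite lieDl !lieDr !liexx add0r addr0.
Qed.
Lemma lie_suml I (r : seq I) (P : pred I) (F : I -> g) z :
  lie (\sum_(i <- r | P i) F i) z = \sum_(i <- r | P i) lie (F i) z.
Proof.
exact: (big_morph (fun x => lie x z) (fun x y => lieDl x y z) (lie0l z)).
Qed.
Lemma lie_sumr I (r : seq I) (P : pred I) (F : I -> g) z :
  lie z (\sum_(i <- r | P i) F i) = \sum_(i <- r | P i) lie z (F i).
Proof.
exact: (big_morph (lie z) (fun x y => lieDr x y z) (lie0r z)).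
Qed.
Lemma lie_leibniz x y z : lie x (lie y z) = lie (lie x y) z + lie y (lie x z).
Proof.
have /eqP := lie_jacobi x y z.
rewrite (lie_antisym z (lie _ _)) (lie_antisym z x) lieNr.
by rewrite -addrA -opprD subr_eq0 addrC => /eqP.
Qed.

End LieTheory.

Section SubQuotient.
Variables (K : fieldType) (V : lmodType K) (Z B : submodClosed V).

Definition submod := {x : V | x \in Z}.
HB.instance Definition _ := SubChoice.on submod.
HB.instance Definition _ := [SubChoice_isSubLmodule of submod by <:].

Definition submod_pred : {pred submod} := [pred x | val x \in B].
Fact submod_pred_closed : submod_closed submod_pred.
Proof.
split=> [|a u v]; first by rewrite inE raddf0 rpred0.
rewrite !inE => uB vB.
by rewrite linearP rpredD ?rpredZ.
Qed.
HB.instance Definition _ :=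
  GRing.isSubmodClosed.Build K submod submod_pred submod_pred_closed.

(** The module [Z / (Z ∩ B)]; below, [B] is always contained in [Z]. *)
Definition subquot := Quotient.quot submod_pred.

HB.instance Definition _ := GRing.Zmodule.on subquot.
HB.instance Definition _ : Quotient submod subquot := Quotient.on subquot.

Definition subquot_scale (a : K) (x : subquot) : subquot :=
  \pi_subquot (a *: repr x).

Lemma subquot_eqE (u v : submod) :
  (\pi_subquot u == \pi_subquot v) = (val (u - v) \in B).
Proof. by rewrite -Quotient.idealrBE. Qed.

Lemma subquot_piD u v :
  \pi_subquot (u + v) = \pi_subquot u + \pi_subquot v.
Proof. exact: Quotient.pi_add. Qed.

Lemma subquot_piZ a v :
  subquot_scale a (\pi_subquot v) = \pi_subquot (a *: v).
Proof.
apply/eqP; rewrite subquot_eqE -scalerBr linearZ rpredZ//.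
by rewrite -subquot_eqE reprK.
Qed.

Fact subquot_scaleA a b x :
  subquot_scale a (subquot_scale b x) = subquot_scale (a * b) x.
Proof.
by rewrite -[x]reprK (subquot_piZ b) (subquot_piZ a) (subquot_piZ (a * b)) scalerA.
Qed.
Fact subquot_scale1 : left_id 1 subquot_scale.
Proof. by move=> x; rewrite -[x]reprK subquot_piZ scale1r. Qed.
Fact subquot_scaleDr : right_distributive subquot_scale +%R.
Proof.
move=> a x y; rewrite -[x]reprK -[y]reprK -subquot_piD !subquot_piZ.
by rewrite -subquot_piD scalerDr.
Qed.
Fact subquot_scaleDl x : {morph subquot_scale^~ x : a b / a + b}.
Proof.
by move=> a b; rewrite -[x]reprK !subquot_piZ -subquot_piD scalerDl.
Qed.

HB.instance Definition _ := GRing.Zmodule_isLmodule.Build K subquot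
  subquot_scaleA subquot_scale1 subquot_scaleDr subquot_scaleDl.

Definition in_submod (v : V) : submod := insubd (0 : submod) v.
(** Only meaningful when [v \in Z]: outside of [Z] the value is [0]. *)
Definition cls (v : V) : subquot := \pi_subquot (in_submod v).
Definition rep (x : subquot) : V := val (repr x).

Lemma in_submodK v : v \in Z -> val (in_submod v) = v.
Proof. exact: insubdK. Qed.

Lemma rep_mem x : rep x \in Z.
Proof. exact: valP. Qed.

Lemma repK : cancel rep cls.
Proof. by move=> x; rewrite /cls /in_submod /rep valKd reprK. Qed.

Lemma cls_eq u v : u \in Z -> v \in Z -> (cls u == cls v) = (u - v \in B).
Proof.
move=> uZ vZ; rewrite subquot_eqE raddfB; congr (_ - _ \in B).
  exact: in_submodK.
exact: in_submodK.
Qed.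

Lemma rep_cls v : v \in Z -> rep (cls v) - v \in B.
Proof. by move=> vZ; rewrite -cls_eq ?rep_mem// repK. Qed.

Lemma cls_linear a u v : u \in Z -> v \in Z ->
  cls (a *: u + v) = a *: cls u + cls v.
Proof.
move=> uZ vZ; have -> : a *: cls u = \pi_subquot (a *: in_submod u).
  exact: subquot_piZ.
rewrite -subquot_piD; congr (\pi _); apply: val_inj.
rewrite linearP in_submodK ?rpredD ?rpredZ//.
by congr (_ *: _ + _); apply/esym; apply: in_submodK.
Qed.

Lemma cls0 : cls 0 = 0.
Proof.
have := @cls_linear (-1) 0 0 (rpred0 _) (rpred0 _).
by rewrite scaler0 addr0 scaleN1r addNr.
Qed.

End SubQuotient.

Section LowerCentralSeries.
Variables (K : fieldType) (g : finLieAlgType K).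
Implicit Types (x y : g) (U V W : {vspace g}).

(** The span of all [lie x y] with [x \in U] and [y \in V]; by bilinearity
    bases of [U] and [V] suffice, see [lie_spanP]. *)
Definition lie_span U V : {vspace g} :=
  <<[seq lie x y | x <- vbasis U, y <- vbasis V]>>%VS.

Fixpoint lcs (i : nat) : {vspace g} :=
  if i is i'.+1 then lie_span (lcs i') fullv else fullv.

Definition nilpotent_lie : Prop := exists n, lcs n = 0%VS.

Lemma mem_lie_span U V x y : x \in U -> y \in V -> lie x y \in lie_span U V.
Proof.
move=> xU yV; rewrite (coord_vbasis xU) (coord_vbasis yV) lie_suml rpred_sum//.
move=> i _; rewrite lie_sumr rpred_sum// => j _; rewrite lieZl lieZr !rpredZ//.
by apply: memv_span; apply: allpairs_f; rewrite mem_nth ?size_tuple.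
Qed.

Lemma lie_spanP U V W :
  (forall x y, x \in U -> y \in V -> lie x y \in W) <-> (lie_span U V <= W)%VS.
Proof.
split=> [H|sW x y xU yV]; last exact: subvP sW _ (mem_lie_span xU yV).
apply/span_subvP => _ /allpairsP[[x y] /= [xU yV ->]].
by apply: H; apply: vbasis_mem.
Qed.

Lemma lcsS i : (lcs i.+1 <= lcs i)%VS.
Proof.
elim: i => [|i IHi]; first exact: subvf.
by apply/lie_spanP => x y /(subvP IHi) xi yf; apply: mem_lie_span.
Qed.

Lemma lcs_dim i : (\dim {:g} <= i)%N -> lcs i.+1 = lcs i.
Proof.
have H j : lcs j.+1 = lcs j \/ (\dim (lcs j) + j <= \dim {:g})%N.
  elim: j => [|j [/= E|IHj]]; [by right; rewrite addn0 | by left; rewrite /= E|].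
  have [E|] := eqVneq (lcs j.+1) (lcs j); first by left; rewrite /= -/(lcs j.+1) E.
  rewrite eqEdim lcsS -ltnNge => lt_dim; right.
  by rewrite addnS; apply: leq_trans IHj; rewrite -addSn leq_add2r.
case: (H i) => // le_dim le_i.
have /eqP : \dim (lcs i) = 0%N.
  apply/eqP; rewrite -leqn0 -(leq_add2r i) add0n.
  exact: leq_trans le_dim le_i.
rewrite dimv_eq0 => /eqP E; have := lcsS i.
by rewrite E subv0 => /eqP.
Qed.

Lemma lie_lcs i j x y :
  x \in lcs i -> y \in lcs j -> lie x y \in lcs (i + j).+1.
Proof.
elim: j i x y => [|j IHj] i x y xi yj.
  by rewrite addn0; apply: mem_lie_span; rewrite ?memvf.
pose W := (linfun (lie x) @^-1: lcs (i + j.+1).+1)%VS.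
have WE z : (z \in W) = (lie x z \in lcs (i + j.+1).+1).
  by rewrite -memv_preim lfunE.
rewrite -WE; apply: subvP yj; apply/lie_spanP => u v uj _.
rewrite WE lie_leibniz rpredD//.
  by rewrite addnS; apply: mem_lie_span; rewrite ?memvf ?IHj.
rewrite lie_antisym rpredN addnS -addSn; apply: IHj => //.
by apply: mem_lie_span; rewrite ?memvf.
Qed.

End LowerCentralSeries.

Section DirectSum.
Variables (K : fieldType) (n : nat) (T : 'I_n -> lmodType K).

Definition dsum := {dffun forall i : 'I_n, T i}.
HB.instance Definition _ := Choice.on dsum.
Implicit Types x y z : dsum.

Definition dsum0 : dsum := [ffun i => 0].
Definition dsum_opp x : dsum := [ffun i => - x i].
Definition dsum_add x y : dsum := [ffun i => x i + y i].
Definition dsum_scale (a : K) x : dsum := [ffun i => a *: x i].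

Fact dsum_addA : associative dsum_add.
Proof. by move=> x y z; apply/ffunP => i; rewrite !ffunE addrA. Qed.
Fact dsum_addC : commutative dsum_add.
Proof. by move=> x y; apply/ffunP => i; rewrite !ffunE addrC. Qed.
Fact dsum_add0 : left_id dsum0 dsum_add.
Proof. by move=> x; apply/ffunP => i; rewrite !ffunE add0r. Qed.
Fact dsum_addN : left_inverse dsum0 dsum_opp dsum_add.
Proof. by move=> x; apply/ffunP => i; rewrite !ffunE addNr. Qed.
HB.instance Definition _ :=
  GRing.isZmodule.Build dsum dsum_addA dsum_addC dsum_add0 dsum_addN.

Fact dsum_scaleA a b x : dsum_scale a (dsum_scale b x) = dsum_scale (a * b) x.
Proof. by apply/ffunP => i; rewrite !ffunE scalerA. Qed.
Fact dsum_scale1 : left_id 1 dsum_scale.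
Proof. by move=> x; apply/ffunP => i; rewrite !ffunE scale1r. Qed.
Fact dsum_scaleDr : right_distributive dsum_scale +%R.
Proof. by move=> a x y; apply/ffunP => i; rewrite !ffunE scalerDr. Qed.
Fact dsum_scaleDl x : {morph dsum_scale^~ x : a b / a + b}.
Proof. by move=> a b; apply/ffunP => i; rewrite !ffunE scalerDl. Qed.
HB.instance Definition _ := GRing.Zmodule_isLmodule.Build K dsum
  dsum_scaleA dsum_scale1 dsum_scaleDr dsum_scaleDl.

Lemma dsumP x y : (forall i, x i = y i) <-> x = y.
Proof. exact: ffunP. Qed.
Lemma dsum0E i : (0 : dsum) i = 0. Proof. by rewrite ffunE. Qed.
Lemma dsumDE x y i : (x + y) i = x i + y i. Proof. by rewrite ffunE. Qed.
Lemma dsumZE a x i : (a *: x) i = a *: x i. Proof. by rewrite ffunE. Qed.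

End DirectSum.

Section Carnot.
Variables (K : fieldType) (g : finLieAlgType K).

Definition gr (i : nat) : lmodType K := subquot (lcs g i) (lcs g i.+1).

(** [gr i] vanishes for [i >= \dim {:g}], see [lcs_dim]. *)
Definition carnot := dsum (fun i : 'I_(\dim {:g}) => gr i).
HB.instance Definition _ := GRing.Lmodule.on carnot.

Definition graded_lie (f h : 'I_(\dim {:g}) -> g) (k : nat) : g :=
  \sum_(i < \dim {:g}) \sum_(j < \dim {:g} | (i + j).+1 == k) lie (f i) (h j).

Definition crep (x : carnot) (i : 'I_(\dim {:g})) : g := rep (x i).

(** The bracket of the classes of [u] in [gr i] and [v] in [gr j] is the class of
    [lie u v] in [gr (i + j).+1]; it does not depend on the representatives, see
    [carnot_lieE]. *)
Definition carnot_lie (x y : carnot) : carnot :=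
  [ffun k : 'I_(\dim {:g}) => cls _ _ (graded_lie (crep x) (crep y) k)].

Implicit Types (f h l : 'I_(\dim {:g}) -> g) (x y z : carnot).

Let graded f := forall i, f i \in lcs g i.
Let eqgr f h := forall i, f i - h i \in lcs g i.+1.

Lemma crep_graded x : graded (crep x).
Proof. by move=> i; apply: rep_mem. Qed.

Lemma graded_lie_graded f h : graded f -> graded h -> graded (graded_lie f h).
Proof.
move=> Hf Hh k; rewrite rpred_sum// => i _; rewrite rpred_sum// => j /eqP <-.
exact: lie_lcs.
Qed.

Lemma graded_lie_eqr f h h' : graded f -> eqgr h h' ->
  eqgr (graded_lie f h) (graded_lie f h').
Proof.
move=> Hf Hh k; rewrite -sumrB rpred_sum// => i _.
rewrite -sumrB rpred_sum// => j /eqP <-.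
by rewrite -lieBr -addnS; apply: lie_lcs.
Qed.

Lemma graded_lie_eql f f' h : eqgr f f' -> graded h ->
  eqgr (graded_lie f h) (graded_lie f' h).
Proof.
move=> Hf Hh k; rewrite -sumrB rpred_sum// => i _.
rewrite -sumrB rpred_sum// => j /eqP <-.
by rewrite -lieBl -addSn; apply: lie_lcs.
Qed.

Lemma crep_linear a x y :
  eqgr (crep (a *: x + y)) (fun i => a *: crep x i + crep y i).
Proof.
move=> i; rewrite /crep dsumDE dsumZE.
rewrite -{1}(repK (x i)) -{1}(repK (y i)) -cls_linear ?rep_mem//.
by apply: rep_cls; rewrite rpredD ?rpredZ ?rep_mem.
Qed.

Lemma crep_lie x y : eqgr (crep (carnot_lie x y)) (graded_lie (crep x) (crep y)).
Proof.
move=> i; rewrite /crep ffunE; apply: rep_cls.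
exact: (graded_lie_graded (crep_graded x) (crep_graded y)).
Qed.

Lemma carnot_lieE x y k f : graded f ->
  eqgr (graded_lie (crep x) (crep y)) f -> carnot_lie x y k = cls _ _ (f k).
Proof.
move=> gf Ef; rewrite ffunE; apply/eqP; rewrite cls_eq ?Ef//.
exact: (graded_lie_graded (crep_graded x) (crep_graded y)).
Qed.

Fact carnot_lie_linearl z : linear (carnot_lie^~ z).
Proof.
move=> a x y; apply/dsumP => k.
have gx := crep_graded x; have gy := crep_graded y; have gz := crep_graded z.
rewrite (@carnot_lieE _ _ _ (graded_lie (fun i => a *: crep x i + crep y i) (crep z))).
- rewrite dsumDE dsumZE !ffunE -cls_linear; last first.
  + exact: (graded_lie_graded gy gz).
  + exact: (graded_lie_graded gx gz).
  congr (cls _ _ _); rewrite scaler_sumr -big_split; apply: eq_bigr => i _ /=.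
  by rewrite scaler_sumr -big_split; apply: eq_bigr => j _; rewrite lieDl lieZl.
- by apply: graded_lie_graded => // i; rewrite rpredD ?rpredZ.
- by apply: graded_lie_eql => //; apply: crep_linear.
Qed.

Fact carnot_lie_linearr z : linear (carnot_lie z).
Proof.
move=> a x y; apply/dsumP => k.
have gx := crep_graded x; have gy := crep_graded y; have gz := crep_graded z.
rewrite (@carnot_lieE _ _ _ (graded_lie (crep z) (fun i => a *: crep x i + crep y i))).
- rewrite dsumDE dsumZE !ffunE -cls_linear; last first.
  + exact: (graded_lie_graded gz gy).
  + exact: (graded_lie_graded gz gx).
  congr (cls _ _ _); rewrite scaler_sumr -big_split; apply: eq_bigr => i _ /=.
  by rewrite scaler_sumr -big_split; apply: eq_bigr => j _; rewrite lieDr lieZr.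
- by apply: graded_lie_graded => // i; rewrite rpredD ?rpredZ.
- by apply: graded_lie_eqr => //; apply: crep_linear.
Qed.

Lemma graded_liexx f k : graded_lie f f k = 0.
Proof.
pose I := 'I_(\dim {:g}); rewrite /graded_lie pair_big_dep /= (bigID (fun p : I * I => p.1 < p.2)%N) /=.
rewrite [X in _ + X](bigID (fun p : I * I => p.2 < p.1)%N) /=.
rewrite [X in _ + (_ + X)]big1 ?addr0; last first.
  move=> [i j] /= /andP[/andP[_]]; rewrite -!leqNgt => ji ij.
  by have -> : i = j by [apply/val_inj/eqP; rewrite eqn_leq ij ji]; rewrite liexx.
rewrite [X in _ + X](reindex_inj (h := fun p : I * I => (p.2, p.1))) /=; last first.
  by move=> [? ?] [? ?] [-> ->].
apply/eqP; rewrite addr_eq0 -sumrN; apply/eqP.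
apply: eq_big => [[i j]|[i j] _] /=; last by rewrite lie_antisym.
by rewrite [(j + i)%N]addnC; case: ltngtP; rewrite ?andbT ?andbF.
Qed.

Fact carnot_liexx x : carnot_lie x x = 0.
Proof. by apply/dsumP => k; rewrite ffunE graded_liexx cls0 dsum0E. Qed.

Lemma graded_lieA f h l (k : 'I_(\dim {:g})) :
  graded_lie f (graded_lie h l) k =
  \sum_(a < \dim {:g}) \sum_(b < \dim {:g}) \sum_(c < \dim {:g})
    (if (a + b + c).+2 == k then lie (f a) (lie (h b) (l c)) else 0).
Proof.
apply: eq_bigr => i _.
under eq_bigr do rewrite lie_sumr.
rewrite exchange_big /=; apply: eq_bigr => j _.
under eq_bigr do rewrite lie_sumr.
rewrite (exchange_big_dep xpredT) //=; apply: eq_bigr => m _.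
case: ifP => [/eqP E|E].
  have lt : ((j + m).+1 < \dim {:g})%N.
    by move: (ltn_ord k); rewrite -E; lia.
  rewrite (big_pred1 (Ordinal lt))// => p; rewrite /= -[RHS]val_eqE /=.
  by apply/andP/eqP => [[/eqP Ep /eqP Em]|Ep]; [lia | split; apply/eqP; lia].
rewrite big_pred0// => p; apply: contraFF E => /andP[/eqP Ep /eqP Em].
by apply/eqP; lia.
Qed.

Fact carnot_lie_jacobi x y z :
  carnot_lie x (carnot_lie y z) + carnot_lie y (carnot_lie z x) +
  carnot_lie z (carnot_lie x y) = 0.
Proof.
have gx := crep_graded x; have gy := crep_graded y; have gz := crep_graded z.
have E u v w k : carnot_lie u (carnot_lie v w) k =
    cls _ _ (graded_lie (crep u) (graded_lie (crep v) (crep w)) k).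
  have gu := crep_graded u; have gv := crep_graded v; have gw := crep_graded w.
  apply: (@carnot_lieE _ _ _ (graded_lie (crep u) (fun i => graded_lie (crep v) (crep w) i)))
    => [|i].
    by apply: graded_lie_graded => //; apply: graded_lie_graded.
  by apply: graded_lie_eqr => //; apply: crep_lie.
have G u v w (k : 'I_(\dim {:g})) : graded_lie (crep u) (graded_lie (crep v) (crep w)) k \in lcs g k.
  have gu := crep_graded u; have gv := crep_graded v; have gw := crep_graded w.
  exact: (graded_lie_graded gu (graded_lie_graded gv gw)).
have D (u v : g) k : u \in lcs g k -> v \in lcs g k ->
    cls (lcs g k) (lcs g k.+1) u + cls _ _ v = cls _ _ (u + v).
  by move=> uk vk; rewrite -[u in RHS]scale1r cls_linear// scale1r.
apply/dsumP => k; rewrite dsum0E !dsumDE !E D// D ?rpredD//.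
rewrite -[RHS]cls0; congr (cls _ _ _); rewrite !graded_lieA.
under [X in _ + X + _]eq_bigr do rewrite exchange_big.
rewrite [X in _ + X + _]exchange_big [X in _ + _ + X]exchange_big /=.
under [X in _ + _ + X]eq_bigr do rewrite exchange_big.
rewrite -!big_split big1//= => a _; rewrite -!big_split big1//= => b _.
rewrite -!big_split big1//= => c _.
have -> : (b + c + a = a + b + c)%N by lia.
have -> : (c + a + b = a + b + c)%N by lia.
by case: ifP => _; rewrite ?addr0// lie_jacobi.
Qed.

HB.instance Definition _ := Lmodule_isLie.Build K carnot
  carnot_lie_linearl carnot_lie_linearr carnot_liexx carnot_lie_jacobi.

End Carnot.

(** A form of degree [k] is an alternating multilinear function of [k]
    arguments, encoded as a function on sequences that vanishes on sequences of
    size different from [k]. *)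

Section Forms.
Variables (K : fieldType) (L : lmodType K).
Local Notation form := (seq L -> K^o).
Implicit Types (a b w : form) (s t r : seq L) (u v x y : L) (c : K).

Definition homogeneous (k : nat) w : Prop := forall s, size s != k -> w s = 0.

Definition multilinear w : Prop := forall s t c u v,
  w (s ++ (c *: u + v) :: t) = c * w (s ++ u :: t) + w (s ++ v :: t).

Definition alternating w : Prop := forall s t r u, w (s ++ u :: t ++ u :: r) = 0.

Definition is_form (k : nat) w : Prop :=
  [/\ homogeneous k w, multilinear w & alternating w].

(** The number of inversions of the shuffle that moves the entries selected by
    [m] in front of the other ones. *)
Definition shuffle_inv (m : bitseq) : nat :=
  \sum_(j < size m) \sum_(i < j) (~~ nth false m i && nth false m j).

(** On homogeneous forms only the masks with the right number of selected
    entries contribute, and this is the usual sum over shuffles. *)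
Definition wedge a b : form := fun s =>
  \sum_(m : (size s).-tuple bool)
    (-1) ^+ shuffle_inv m * a (mask m s) * b (mask (map negb m) s).

Definition form1 : form := fun s => (s == [::])%:R.

Definition contr x w : form := fun s => w (x :: s).
Definition grinv w : form := fun s => (-1) ^+ size s * w s.

Lemma formDE a b s : (a + b) s = a s + b s. Proof. by []. Qed.
Lemma formNE a s : (- a) s = - a s. Proof. by []. Qed.
Lemma formZE c a s : (c *: a) s = c * a s. Proof. by []. Qed.
Lemma form0E s : (0 : form) s = 0. Proof. by []. Qed.
Definition formE := (formDE, formNE, formZE, form0E).

Definition altform w : Prop := multilinear w /\ alternating w.

Lemma altform_contr x w : altform w -> altform (contr x w).
Proof.
by move=> [mw aw]; split=> [s t c u v|s t r u];
  [apply: (mw (x :: s)) | apply: (aw (x :: s))].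
Qed.

Lemma altform_grinv w : altform w -> altform (grinv w).
Proof.
move=> [mw aw]; split=> [s t c u v|s t r u]; rewrite /grinv ?aw ?mulr0// mw.
by rewrite !size_cat /= mulrDr mulrCA.
Qed.

Lemma altformD a b : altform a -> altform b -> altform (a + b).
Proof.
move=> [ma aa] [mb ab]; split=> [s t c u v|s t r u]; rewrite !formE.
  by rewrite ma mb mulrDr addrACA.
by rewrite aa ab addr0.
Qed.

Lemma altformZ c a : altform a -> altform (c *: a).
Proof.
move=> [ma aa]; split=> [s t d u v|s t r u]; rewrite !formE.
  by rewrite ma mulrDr mulrCA.
by rewrite aa mulr0.
Qed.

Lemma altform0 : altform 0.
Proof. by split=> [s t c u v|s t r u]; rewrite !formE// mulr0 addr0. Qed.

Lemma altformB a b : altform a -> altform b -> altform (a - b).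
Proof.
by move=> ha hb; apply: altformD => //; rewrite -scaleN1r; apply: altformZ.
Qed.

Lemma multilinear0 w s t : multilinear w -> w (s ++ 0 :: t) = 0.
Proof.
move=> mw; have := mw s t (-1) 0 0.
by rewrite scaler0 addr0 mulN1r addNr.
Qed.

Lemma altform_adj w : multilinear w ->
  (forall s r u, w (s ++ u :: u :: r) = 0) -> altform w.
Proof.
move=> mw aw; split=> // s t r u.
have mD s' t' x y : w (s' ++ (x + y) :: t') = w (s' ++ x :: t') + w (s' ++ y :: t').
  by rewrite -[x in LHS]scale1r mw mul1r.
have sw s' r' x y : w (s' ++ x :: y :: r') = - w (s' ++ y :: x :: r').
  apply/eqP; rewrite -addr_eq0; apply/eqP.
  have := aw s' r' (x + y); rewrite mD.
  rewrite -[s' ++ x :: (x + y) :: r']cat_rcons -[s' ++ y :: (x + y) :: r']cat_rcons.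
  by rewrite !mD !cat_rcons !aw add0r addr0.
elim: t s => [|y t IHt] s /=; first exact: aw.
by rewrite sw -cat_rcons IHt oppr0.
Qed.

Lemma altform_swap w x y s : altform w -> w (x :: y :: s) = - w (y :: x :: s).
Proof.
move=> [mw aw]; apply/eqP; rewrite -addr_eq0; apply/eqP.
have mD s' t' u v : w (s' ++ (u + v) :: t') = w (s' ++ u :: t') + w (s' ++ v :: t').
  by rewrite -[u in LHS]scale1r mw mul1r.
have := aw [::] [::] s (x + y); rewrite /= (mD [::]) /= (mD [:: x]) (mD [:: y]) /=.
by rewrite (aw [::] [::] s x) (aw [::] [::] s y) add0r addr0.
Qed.

Lemma shuffle_inv_cons e (m : bitseq) :
  shuffle_inv (e :: m) = ((if e then 0 else count id m) + shuffle_inv m)%N.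
Proof.
rewrite /shuffle_inv /= big_ord_recl big_ord0 add0n.
transitivity (\sum_(j < size m) \sum_(i < j.+1)
    (~~ nth false (e :: m) i && nth false m j))%N; first by [].
transitivity (\sum_(j < size m) ((~~ e && nth false m j) +
    \sum_(i < j) (~~ nth false m i && nth false m j)))%N.
  by apply: eq_bigr => j _; rewrite big_ord_recl.
rewrite big_split /=; congr (_ + _)%N.
case: e => /=; first by rewrite big1.
by rewrite -sum1_count [RHS]big_mkcond (big_nth false) big_mkord; apply: eq_bigr => i _; case: nth.
Qed.

Lemma wedge_nil a b : wedge a b [::] = a [::] * b [::].
Proof.
rewrite /wedge /= (big_pred1 [tuple]) => [|m]; last by rewrite [m]tuple0 /= eqxx.
by rewrite /shuffle_inv big_ord0 expr0 mul1r.
Qed.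

Lemma wedge_cons a b x s :
  wedge a b (x :: s) = wedge (contr x a) b s + wedge (grinv a) (contr x b) s.
Proof.
rewrite /wedge /=.
pose h (p : bool * (size s).-tuple bool) := [tuple of p.1 :: p.2].
rewrite (reindex h) /=; last first.
  exists (fun m => (thead m, [tuple of behead m])) => [[e m]|m] _.
    by congr (_, _); apply: val_inj.
  by rewrite /h -tuple_eta.
rewrite -(pair_bigA _ (fun e m => (-1) ^+ shuffle_inv (h (e, m)) *
  a (mask (h (e, m)) (x :: s)) * b (mask (map negb (h (e, m))) (x :: s)))) /=.
rewrite big_bool /=; congr (_ + _); apply: eq_bigr => m _.
  by rewrite shuffle_inv_cons.
rewrite shuffle_inv_cons exprD /grinv /contr size_mask ?size_tuple//.
by rewrite [_ * (_ * a _)]mulrCA -!mulrA.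
Qed.

Lemma wedgeDl a b w : wedge (a + b) w = wedge a w + wedge b w.
Proof.
apply/funext => s; rewrite /wedge !formE -big_split /=; apply: eq_bigr => m _.
by rewrite mulrDr mulrDl.
Qed.
Lemma wedgeDr a b w : wedge w (a + b) = wedge w a + wedge w b.
Proof.
apply/funext => s; rewrite /wedge !formE -big_split /=; apply: eq_bigr => m _.
by rewrite mulrDr.
Qed.
Lemma wedgeZl c a w : wedge (c *: a) w = c *: wedge a w.
Proof.
apply/funext => s; rewrite /wedge !formE mulr_sumr; apply: eq_bigr => m _.
by rewrite !mulrA [_ * c]mulrC.
Qed.
Lemma wedgeZr c a w : wedge w (c *: a) = c *: wedge w a.
Proof.
apply/funext => s; rewrite /wedge !formE mulr_sumr; apply: eq_bigr => m _.
by rewrite mulrCA.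
Qed.
Lemma wedgeNl a w : wedge (- a) w = - wedge a w.
Proof. by rewrite -scaleN1r wedgeZl scaleN1r. Qed.
Lemma wedgeNr a w : wedge w (- a) = - wedge w a.
Proof. by rewrite -scaleN1r wedgeZr scaleN1r. Qed.
Lemma wedgeBl a b w : wedge (a - b) w = wedge a w - wedge b w.
Proof. by rewrite wedgeDl wedgeNl. Qed.
Lemma wedgeBr a b w : wedge w (a - b) = wedge w a - wedge w b.
Proof. by rewrite wedgeDr wedgeNr. Qed.
Lemma wedge0l w : wedge 0 w = 0.
Proof. by apply: (addIr (wedge 0 w)); rewrite -wedgeDl !add0r. Qed.
Lemma wedge0r w : wedge w 0 = 0.
Proof. by apply: (addIr (wedge w 0)); rewrite -wedgeDr !add0r. Qed.

Lemma contr_wedge x a b :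
  contr x (wedge a b) = wedge (contr x a) b + wedge (grinv a) (contr x b).
Proof. by apply/funext => s; apply: wedge_cons. Qed.

Lemma contr_grinv x a : contr x (grinv a) = - grinv (contr x a).
Proof. by apply/funext => s; rewrite formE /contr /grinv /= exprS mulN1r mulNr. Qed.

Lemma grinvK a : grinv (grinv a) = a.
Proof.
by apply/funext => s; rewrite /grinv mulrA -exprD addnn -mul2n exprM sqrrN !expr1n mul1r.
Qed.

Lemma contr_linear w c u v : multilinear w ->
  contr (c *: u + v) w = c *: contr u w + contr v w.
Proof. by move=> mw; apply/funext => s; apply: (mw [::]). Qed.

Lemma contrC w x y : altform w -> contr x (contr y w) = - contr y (contr x w).
Proof. by move=> hw; apply/funext => s; rewrite formE; apply: altform_swap. Qed.

Lemma contr2 w x : altform w -> contr x (contr x w) = 0.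
Proof. by move=> [_ aw]; apply/funext => s; apply: (aw [::] [::]). Qed.

Lemma wedge_multilinear a b : multilinear a -> multilinear b ->
  multilinear (wedge a b).
Proof.
move=> ma mb s; elim: s a b ma mb => [|x s IHs] a b ma mb t c u v.
  rewrite -![wedge a b _]/(contr _ (wedge a b) t) !contr_wedge !contr_linear//.
  rewrite wedgeDl wedgeDr wedgeZl wedgeZr !formE mulrDr.
  by rewrite addrACA.
have mc w : multilinear w -> multilinear (contr x w).
  by move=> mw s' ?; apply: (mw (x :: s')).
have mg w : multilinear w -> multilinear (grinv w).
  by move=> mw s' t' d y z; rewrite /grinv mw !size_cat mulrDr mulrCA.
rewrite /= !wedge_cons IHs//; [|exact: mc]; rewrite IHs//; [|exact: mg|exact: mc].
by rewrite mulrDr addrACA.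
Qed.

Lemma wedge_altform a b : altform a -> altform b -> altform (wedge a b).
Proof.
move=> ha hb; apply: altform_adj; first by case: ha hb => [? _] [? _]; apply: wedge_multilinear.
move=> s; elim: s a b ha hb => [|x s IHs] a b ha hb r u; last first.
  by rewrite /= wedge_cons !IHs ?addr0//; (do ?apply: altform_contr); (do ?apply: altform_grinv).
rewrite /= -[wedge a b _]/(contr u (contr u (wedge a b)) r).
rewrite contr_wedge -[contr u (_ + _)]/(contr u (wedge _ _) + contr u (wedge _ _)).
rewrite !contr_wedge !contr2// contr_grinv wedgeNl wedge0l wedge0r.
by rewrite add0r addr0 subrr.
Qed.

Lemma wedge_homogeneous p q a b : homogeneous p a -> homogeneous q b ->
  homogeneous (p + q) (wedge a b).
Proof.
move=> ha hb s ns; rewrite /wedge big1// => m _.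
have E : (size (mask m s) + size (mask (map negb m) s) = size s)%N.
  rewrite !size_mask ?size_map ?size_tuple// count_map.
  by rewrite -[RHS](size_tuple m) -(count_predC id m).
have [Ep|np] := eqVneq (size (mask m s)) p; last by rewrite ha// mulr0 mul0r.
rewrite (hb (mask _ s)) ?mulr0//; apply: contra ns => /eqP Eq.
by rewrite -E Ep Eq.
Qed.

Lemma is_form_wedge p q a b : is_form p a -> is_form q b ->
  is_form (p + q) (wedge a b).
Proof.
move=> [ha ma aa] [hb mb ab]; have [? ?] := wedge_altform (conj ma aa) (conj mb ab); split => //.
exact: wedge_homogeneous.
Qed.

Lemma is_form_altform k w : is_form k w -> altform w.
Proof. by case. Qed.

Lemma is_formD k a b : is_form k a -> is_form k b -> is_form k (a + b).
Proof.
move=> [ha ma aa] [hb mb ab]; have [? ?] := altformD (conj ma aa) (conj mb ab); split => // s ns.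
by rewrite formE ha// hb// addr0.
Qed.

Lemma is_formZ k c a : is_form k a -> is_form k (c *: a).
Proof.
move=> [ha ma aa]; have [? ?] := altformZ c (conj ma aa); split => // s ns.
by rewrite formE ha// mulr0.
Qed.

Lemma is_form0 k : is_form k 0.
Proof. by have [? ?] := altform0; split. Qed.

Lemma is_form1 : is_form 0 form1.
Proof.
split=> [s|s t c u v|s t r u]; rewrite /form1; first by rewrite size_eq0 => /negPf->.
  by rewrite -!size_eq0 !size_cat !addnS mulr0 addr0.
by rewrite -size_eq0 size_cat addnS.
Qed.

End Forms.

Section ChevalleyEilenberg.
Variables (K : fieldType) (g : lieAlgType K).
Local Notation form := (seq g -> K^o).
Implicit Types (a b w : form) (s t r : seq g) (u v x y : g) (c : K).

Definition del (i : nat) s : seq g := take i s ++ drop i.+1 s.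

(** As [i < j], [del i (del j s)] drops the entries [i] and [j] of [s]. *)
Definition ce_diff w : form := fun s =>
  \sum_(j < size s) \sum_(i < j)
    (-1) ^+ (i + j) * w (lie s`_i s`_j :: del i (del j s)).

Definition lie_der x w : form := fun s =>
  \sum_(j < size s) (-1) ^+ j.+1 * w (lie x s`_j :: del j s).

Lemma del0 x s : del 0 (x :: s) = s.
Proof. by rewrite /del /= drop0. Qed.

Lemma size_del i s : (i < size s)%N -> size (del i s) = (size s).-1.
Proof. by move=> lt; rewrite size_cat size_take lt size_drop; lia. Qed.

Lemma lie_der_linear x c a b : lie_der x (c *: a + b) = c *: lie_der x a + lie_der x b.
Proof.
apply/funext => s; rewrite !formE mulr_sumr -big_split; apply: eq_bigr => j _.
by rewrite !formE mulrDr mulrCA.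
Qed.
Lemma lie_derD x a b : lie_der x (a + b) = lie_der x a + lie_der x b.
Proof. by rewrite -[a in LHS]scale1r lie_der_linear scale1r. Qed.
Lemma lie_der0 x : lie_der x 0 = 0.
Proof. by apply: (addIr (lie_der x 0)); rewrite -lie_derD !add0r. Qed.
Lemma lie_derN x a : lie_der x (- a) = - lie_der x a.
Proof. by rewrite -scaleN1r -[_ *: a]addr0 lie_der_linear lie_der0 addr0 scaleN1r. Qed.
Lemma lie_derB x a b : lie_der x (a - b) = lie_der x a - lie_der x b.
Proof. by rewrite lie_derD lie_derN. Qed.

Lemma ce_diff_linear c a b : ce_diff (c *: a + b) = c *: ce_diff a + ce_diff b.
Proof.
apply/funext => s; rewrite !formE mulr_sumr -big_split; apply: eq_bigr => j _.
rewrite mulr_sumr -big_split; apply: eq_bigr => i _.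
by rewrite !formE mulrDr mulrCA.
Qed.
Lemma ce_diffD a b : ce_diff (a + b) = ce_diff a + ce_diff b.
Proof. by rewrite -[a in LHS]scale1r ce_diff_linear scale1r. Qed.
Lemma ce_diff0 : ce_diff 0 = 0.
Proof. by apply: (addIr (ce_diff 0)); rewrite -ce_diffD !add0r. Qed.
Lemma ce_diffZ c a : ce_diff (c *: a) = c *: ce_diff a.
Proof. by rewrite -[_ *: a in LHS]addr0 ce_diff_linear ce_diff0 addr0. Qed.
Lemma ce_diffN a : ce_diff (- a) = - ce_diff a.
Proof. by rewrite -scaleN1r ce_diffZ scaleN1r. Qed.
Lemma ce_diffB a b : ce_diff (a - b) = ce_diff a - ce_diff b.
Proof. by rewrite ce_diffD ce_diffN. Qed.

Lemma contr_lie_der x y w : altform w ->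
  contr y (lie_der x w) = lie_der x (contr y w) - contr (lie x y) w.
Proof.
move=> hw; apply/funext => s; rewrite !formE /contr /lie_der /= big_ord_recl.
rewrite addrC; congr (_ + _); last by rewrite expr1 mulN1r del0.
by apply: eq_bigr => j _; rewrite /= altform_swap// exprS mulN1r mulrNN.
Qed.

Lemma contr_ce_diff x w : altform w ->
  contr x (ce_diff w) = lie_der x w - ce_diff (contr x w).
Proof.
move=> hw; apply/funext => s; rewrite !formE /contr /lie_der /ce_diff /=.
rewrite big_ord_recl big_ord0 add0r -sumrB; apply: eq_bigr => j _.
transitivity (\sum_(i < j.+1) (-1) ^+ (i + j.+1) *
   (w (lie (x :: s)`_i s`_j :: del i (x :: del j s)) : K)); first by [].
rewrite big_ord_recl add0n /= del0 -sumrN; congr (_ + _); apply: eq_bigr => i _.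
by rewrite /= altform_swap// addnS addSn !exprS !mulN1r opprK mulrN.
Qed.

Lemma lie_der_grinv x w : lie_der x (grinv w) = grinv (lie_der x w).
Proof.
apply/funext => s; rewrite /grinv mulr_sumr; apply: eq_bigr => j _ /=.
by rewrite size_del// prednK 1?mulrCA//; apply: leq_ltn_trans (ltn_ord j).
Qed.

Lemma ce_diff_grinv w : ce_diff (grinv w) = - grinv (ce_diff w).
Proof.
apply/funext => s; rewrite !formE /grinv mulr_sumr -sumrN; apply: eq_bigr => j _ /=.
rewrite mulr_sumr -sumrN; apply: eq_bigr => i _ /=.
have lj := ltn_ord j; have lij := ltn_ord i.
have sj := size_del lj.
have lt : (i < size (del j s))%N by rewrite sj; lia.
rewrite size_del// prednK ?sj; last by lia.
have -> : (-1) ^+ size s = - (-1) ^+ (size s).-1 :> K.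
  have : (0 < size s)%N by lia.
  by case: {+}(size s) => // n _; rewrite exprS mulN1r.
by rewrite mulNr opprK mulrCA.
Qed.

Lemma lie_der_multilinear x w : altform w -> multilinear (lie_der x w).
Proof.
move=> hw s; elim: s w hw => [|y s IHs] w hw t c u v /=; last first.
  rewrite -![lie_der x w _]/(contr y (lie_der x w) _) contr_lie_der// !formE.
  rewrite IHs; last exact: altform_contr.
  rewrite [contr _ _ _](_ : _ = c * contr (lie x y) w (s ++ u :: t) +
    contr (lie x y) w (s ++ v :: t)); last exact: (hw.1 (_ :: _)).
  by rewrite opprD addrACA -mulrBr.
rewrite -![lie_der x w _]/(contr _ (lie_der x w) t) !contr_lie_der// !formE.
rewrite lieDr lieZr !contr_linear; try exact: hw.1.
by rewrite lie_der_linear !formE opprD addrACA -mulrBr.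
Qed.

Lemma altform_lie_der x w : altform w -> altform (lie_der x w).
Proof.
move=> hw; apply: altform_adj; first exact: lie_der_multilinear.
move=> s; elim: s w hw => [|y s IHs] w hw r u /=.
  rewrite -[lie_der x w _]/(contr u (contr u (lie_der x w)) r) contr_lie_der//.
  rewrite -[contr u (_ - _)]/(contr u (lie_der _ _) - contr u (contr _ _)).
  rewrite contr_lie_der; last exact: altform_contr.
  rewrite contr2// lie_der0 sub0r (contrC u)// opprK !formE.
  by rewrite addrC subrr.
rewrite -[lie_der x w _]/(contr y (lie_der x w) _) contr_lie_der// !formE.
rewrite IHs; last exact: altform_contr.
by rewrite -[contr _ _ _]/(w ((_ :: s) ++ u :: [::] ++ u :: r)) hw.2 subr0.
Qed.

Lemma ce_diff_multilinear w : altform w -> multilinear (ce_diff w).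
Proof.
move=> hw s; elim: s w hw => [|y s IHs] w hw t c u v /=; last first.
  rewrite -![ce_diff w _]/(contr y (ce_diff w) _) contr_ce_diff// !formE.
  rewrite IHs; last exact: altform_contr.
  by rewrite lie_der_multilinear// opprD addrACA -mulrBr.
rewrite -![ce_diff w _]/(contr _ (ce_diff w) t) !contr_ce_diff// !formE.
rewrite contr_linear; last exact: hw.1.
rewrite ce_diff_linear !formE.
suff -> : lie_der (c *: u + v) w t = c * lie_der u w t + lie_der v w t.
  by rewrite opprD addrACA -mulrBr.
rewrite /lie_der mulr_sumr -big_split; apply: eq_bigr => j _ /=.
by rewrite lieDl lieZl (hw.1 [::]) mulrDr mulrCA.
Qed.

Lemma altform_ce_diff w : altform w -> altform (ce_diff w).
Proof.
move=> hw; apply: altform_adj; first exact: ce_diff_multilinear.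
move=> s; elim: s w hw => [|y s IHs] w hw r u /=.
  rewrite -[ce_diff w _]/(contr u (contr u (ce_diff w)) r) contr_ce_diff//.
  rewrite -[contr u (_ - _)]/(contr u (lie_der _ _) - contr u (ce_diff _)).
  rewrite contr_lie_der// contr_ce_diff; last exact: altform_contr.
  rewrite contr2// ce_diff0 subr0 liexx !formE /contr.
  by rewrite (@multilinear0 _ _ w [::])// ?subr0 ?subrr//; apply: hw.1.
rewrite -[ce_diff w _]/(contr y (ce_diff w) _) contr_ce_diff// !formE.
rewrite IHs; last exact: altform_contr.
by rewrite ((altform_lie_der y hw).2 s [::]) subr0.
Qed.

Lemma ce_diff_homogeneous k w : homogeneous k w -> homogeneous k.+1 (ce_diff w).
Proof.
move=> hw s ns; rewrite /ce_diff big1// => j _; rewrite big1// => i _.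
rewrite hw ?mulr0//=; have lj := ltn_ord j; have lij := ltn_ord i.
have sj := size_del lj.
have lt : (i < size (del j s))%N by rewrite sj; lia.
rewrite size_del// sj; apply: contraNneq ns => <-.
have : (1 < size s)%N := leq_ltn_trans (leq_ltn_trans (leq0n i) lij) lj.
by case: {+}(size s) => [|[]].
Qed.

Lemma is_form_ce_diff k w : is_form k w -> is_form k.+1 (ce_diff w).
Proof.
move=> [hw mw aw]; have [? ?] := altform_ce_diff (conj mw aw).
by split => //; apply: ce_diff_homogeneous.
Qed.

Lemma altform_eq a b : (a [::] = b [::]) ->
  (forall x, contr x a = contr x b) -> a = b.
Proof.
move=> E0 E; apply/funext => -[//|x s].
exact: (congr1 (fun w => w s) (E x)).
Qed.

Lemma lie_der_nil x w : lie_der x w [::] = 0.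
Proof. by rewrite /lie_der big_ord0. Qed.
Lemma ce_diff_nil w : ce_diff w [::] = 0.
Proof. by rewrite /ce_diff big_ord0. Qed.

Lemma lie_der_wedge x a b : altform a -> altform b ->
  lie_der x (wedge a b) = wedge (lie_der x a) b + wedge a (lie_der x b).
Proof.
move=> ha hb; apply/funext => s; elim: s a b ha hb => [|y s IHs] a b ha hb.
  by rewrite formE lie_der_nil !wedge_nil !lie_der_nil mul0r mulr0 addr0.
have [[hga hca] hcb] := (altform_grinv ha, altform_contr y ha, altform_contr y hb).
rewrite -[LHS]/(contr y (lie_der x (wedge a b)) s).
rewrite contr_lie_der; last exact: wedge_altform.
rewrite !contr_wedge lie_derD !formE !IHs// !formE !wedge_cons !contr_lie_der//.
rewrite wedgeBl wedgeBr lie_der_grinv !formE.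
move: (wedge _ _ s) (wedge _ _ s) (wedge _ _ s) (wedge _ _ s) (wedge _ _ s) (wedge _ _ s).
by move=> *; ring.
Qed.

Lemma ce_diff_wedge a b : altform a -> altform b ->
  ce_diff (wedge a b) = wedge (ce_diff a) b + wedge (grinv a) (ce_diff b).
Proof.
move=> ha hb; apply/funext => s; elim: s a b ha hb => [|x s IHs] a b ha hb.
  by rewrite formE ce_diff_nil !wedge_nil !ce_diff_nil mul0r mulr0 addr0.
have [[hga hca] hcb] := (altform_grinv ha, altform_contr x ha, altform_contr x hb).
rewrite -[LHS]/(contr x (ce_diff (wedge a b)) s).
rewrite contr_ce_diff; last exact: wedge_altform.
rewrite lie_der_wedge// !contr_wedge ce_diffD !formE !IHs// !formE.
rewrite !wedge_cons !contr_ce_diff// contr_grinv ce_diff_grinv grinvK.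
rewrite wedgeBl wedgeBr !wedgeNl !formE.
move: (wedge _ _ s) (wedge _ _ s) (wedge _ _ s) (wedge _ _ s) (wedge _ _ s) (wedge _ _ s).
by move=> *; ring.
Qed.

Lemma lie_der_lie x y w : altform w ->
  lie_der (lie x y) w = lie_der x (lie_der y w) - lie_der y (lie_der x w).
Proof.
move=> hw; apply/funext => s; elim: s w hw => [|z s IHs] w hw.
  by rewrite !formE !lie_der_nil subr0.
have [[hx hy] hc] := (altform_lie_der x hw, altform_lie_der y hw, altform_contr z hw).
rewrite !formE -![lie_der _ _ (z :: s)]/(contr z (lie_der _ _) s).
rewrite !contr_lie_der// !lie_derB !formE.
rewrite (IHs (contr z w))// !formE.
have -> : contr (lie (lie x y) z) w s =
    contr (lie x (lie y z)) w s - contr (lie y (lie x z)) w s.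
  rewrite lie_leibniz -[lie (lie x y) z in RHS]scale1r.
  by rewrite /contr (hw.1 [::]) mul1r addrK.
move: (contr _ _ s) (contr _ _ s); move=> *; ring.
Qed.

Lemma lie_der_ce_diff x w : altform w ->
  lie_der x (ce_diff w) = ce_diff (lie_der x w).
Proof.
move=> hw; apply/funext => s; elim: s w hw => [|y s IHs] w hw.
  by rewrite lie_der_nil ce_diff_nil.
have [[hx hd] hc] := (altform_lie_der x hw, altform_ce_diff hw, altform_contr y hw).
rewrite -[LHS]/(contr y (lie_der _ _) s) -[RHS]/(contr y (ce_diff _) s).
rewrite contr_lie_der// !contr_ce_diff// contr_lie_der// lie_derB ce_diffB !formE.
rewrite IHs// lie_der_lie// !formE.
by ring.
Qed.

Lemma ce_diffK w : altform w -> ce_diff (ce_diff w) = 0.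
Proof.
move=> hw; apply/funext => s; elim: s w hw => [|y s IHs] w hw.
  by rewrite ce_diff_nil.
have [hd hc] := (altform_ce_diff hw, altform_contr y hw).
rewrite -[LHS]/(contr y (ce_diff _) s) contr_ce_diff// contr_ce_diff//.
by rewrite ce_diffB lie_der_ce_diff// !formE IHs// form0E subr0 subrr.
Qed.

End ChevalleyEilenberg.

Section Cohomology.
Variables (K : fieldType) (g : lieAlgType K).
Local Notation form := (seq g -> K^o).
Implicit Types (a b w : form) (k p q : nat).

Definition is_cocycle k w : Prop := is_form k w /\ ce_diff w = 0.

Definition is_coboundary k w : Prop :=
  if k is k'.+1 then exists2 a, is_form k' a & w = ce_diff a else w = 0.

Definition cocycle k : {pred form} := fun w => `[< is_cocycle k w >].
Definition coboundary k : {pred form} := fun w => `[< is_coboundary k w >].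

Lemma cocycleP k w : reflect (is_cocycle k w) (w \in cocycle k).
Proof. exact: asboolP. Qed.
Lemma coboundaryP k w : reflect (is_coboundary k w) (w \in coboundary k).
Proof. exact: asboolP. Qed.

Fact cocycle_closed k : submod_closed (cocycle k).
Proof.
split=> [|c a b /cocycleP[ha da] /cocycleP[hb db]]; apply/cocycleP.
  by split; [apply: is_form0 | rewrite ce_diff0].
split; first by apply: is_formD => //; apply: is_formZ.
by rewrite ce_diff_linear da db scaler0 addr0.
Qed.
HB.instance Definition _ k :=
  GRing.isSubmodClosed.Build K form (cocycle k) (cocycle_closed k).

Fact coboundary_closed k : submod_closed (coboundary k).
Proof.
case: k => [|k]; split=> [|c a b].
- exact/coboundaryP.
- by move=> /coboundaryP/= -> /coboundaryP/= ->; rewrite scaler0 addr0; apply/coboundaryP.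
- by apply/coboundaryP; exists 0; [apply: is_form0 | rewrite ce_diff0].
move=> /coboundaryP[a' ha ->] /coboundaryP[b' hb ->].
apply/coboundaryP; exists (c *: a' + b'); last by rewrite ce_diff_linear.
by apply: is_formD => //; apply: is_formZ.
Qed.
HB.instance Definition _ k :=
  GRing.isSubmodClosed.Build K form (coboundary k) (coboundary_closed k).

Lemma coboundary_cocycle k : {subset coboundary k <= cocycle k}.
Proof.
case: k => [|k] w /coboundaryP => [/= ->|[a ha ->]]; first exact: rpred0.
apply/cocycleP; split; first exact: is_form_ce_diff.
exact/ce_diffK/is_form_altform/ha.
Qed.

Definition cohomology k : lmodType K := subquot (cocycle k) (coboundary k).

Definition cohom_class k w : cohomology k := cls (cocycle k) (coboundary k) w.

Definition cohom1 : cohomology 0 := cohom_class 0 (@form1 K g).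

(** Independent of the representatives, see [cup_class]. *)
Definition cup p q (x : cohomology p) (y : cohomology q) : cohomology (p + q) :=
  cohom_class (p + q) (wedge (rep x) (rep y)).

Lemma cocycle1 : @form1 K g \in cocycle 0.
Proof.
apply/cocycleP; split; first exact: is_form1.
apply/funext => s; rewrite /ce_diff big1// => j _; rewrite big1// => i _.
by rewrite /form1 mulr0.
Qed.

Lemma cocycle_wedge p q a b :
  a \in cocycle p -> b \in cocycle q -> wedge a b \in cocycle (p + q).
Proof.
move=> /cocycleP[ha da] /cocycleP[hb db]; apply/cocycleP.
split; first exact: is_form_wedge.
have [aa ab] := (is_form_altform ha, is_form_altform hb).
by rewrite ce_diff_wedge// da db wedge0l wedge0r addr0.
Qed.

Lemma grinv_form k a : is_form k a -> grinv a = (-1) ^+ k *: a.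
Proof.
move=> [ha _ _]; apply/funext => s; rewrite !formE /grinv.
by have [->//|/ha->] := eqVneq (size s) k; rewrite !mulr0.
Qed.

Lemma wedge_coboundaryl p q a b :
  a \in coboundary p -> b \in cocycle q -> wedge a b \in coboundary (p + q).
Proof.
case: p => [|p] /coboundaryP => [/= ->|[c hc ->]] /cocycleP[hb db].
  by rewrite wedge0l rpred0.
have [ac ab] := (is_form_altform hc, is_form_altform hb).
apply/coboundaryP; exists (wedge c b); first exact: is_form_wedge.
by rewrite ce_diff_wedge// db wedge0r addr0.
Qed.

Lemma wedge_coboundaryr p q a b :
  a \in cocycle p -> b \in coboundary q -> wedge a b \in coboundary (p + q).
Proof.
move=> /cocycleP[ha da]; case: q => [|q] /coboundaryP => [/= ->|[c hc ->]].
  by rewrite wedge0r rpred0.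
have [aa ac] := (is_form_altform ha, is_form_altform hc).
rewrite addnS; apply/coboundaryP; exists ((-1) ^+ p *: wedge a c).
  by apply: is_formZ; apply: is_form_wedge.
rewrite ce_diffZ ce_diff_wedge// da wedge0l add0r (grinv_form ha) wedgeZl.
by rewrite scalerA -exprD addnn -mul2n exprM sqrrN !expr1n scale1r.
Qed.

Lemma cup_class p q a b : a \in cocycle p -> b \in cocycle q ->
  cup (cohom_class p a) (cohom_class q b) = cohom_class (p + q) (wedge a b).
Proof.
move=> ha hb; have [ra rb] := (rep_mem (cohom_class p a), rep_mem (cohom_class q b)).
apply/eqP; rewrite cls_eq ?cocycle_wedge//.
rewrite -[X in X \in _](subrKA (wedge a (rep (cohom_class q b)))) -wedgeBl -wedgeBr.
apply: rpredD; first by apply: wedge_coboundaryl rb; apply: rep_cls.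
by apply: wedge_coboundaryr ha _; apply: rep_cls.
Qed.

End Cohomology.

Definition cohomology_isomorphic (K : fieldType) (g h : lieAlgType K) : Prop :=
  exists f : forall k, {linear cohomology g k -> cohomology h k},
    [/\ forall k, bijective (f k),
        f 0 (cohom1 g) = cohom1 h &
        forall p q (x : cohomology g p) (y : cohomology g q),
          f (p + q)%N (cup x y) = cup (f p x) (f q y)].

(* Main.v *)
Require Import Defs.
From HB Require Import structures.
From mathcomp Require Import all_boot all_algebra reals.
From mathcomp Require Import zify ring boolp functions.

(** Take the five-dimensional algebras [filiform t] with basis e0, ..., e4 and
    brackets [e0,e1] = e2, [e0,e2] = e3, [e0,e3] = e4, [e1,e2] = t e4, for
    t = 0 and t = 1.

    Carnot algebras.  All [filiform t] have the same lower central series.  The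
    vectors e1 and e2 have filtration degrees 0 and 1, so their bracket is only
    seen in degree 2 of the associated graded algebra, whereas e4 has degree 3:
    the parameter t is lost ([carnot_isomorphic], [filiform_carnot]).

    Non-isomorphism.  For t = 0 the vectors X = e0, Y = e1 satisfy
    [Y,[X,Y]] = 0 and [X,[X,[X,Y]]] <> 0, and in coordinates no such pair exists
    for t <> 0 ([filiform_not_isomorphic]).

    Cohomology.  Let eps_j be the dual basis, i_j the contraction with e_j, D
    the Lie derivative along e0, and grinv the sign (-1)^deg.  The differential
    of [filiform t] is

      d_t = eps_0 D - t eps_1 eps_2 i_4                          ([ce_diffE]).

    Put N w = eps_1 grinv (D (i_0 w)).  Then N N = 0, and the operator
    [twist t] = 1 + t N = exp (t N) is an isomorphism of complexes from
    (forms, d_0) to (forms, d_t) ([twist_diff]).  The reason is that modulo eps_0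
    and eps_1 the derivation D extends a nilpotent Jordan block of size 3, and on
    the exterior algebra of a three-dimensional space the square of such a
    derivation is eps_2 i_4 up to the sign -(-1)^deg ([D_sqr]).

    The operator [twist t] is not multiplicative on forms, but on d_0-cocycles
    a and b its defect is t (N (a b) - (N a) b - a (N b)), and this is d_t-exact
    ([twist_wedge]).  To see it, write a = u + eps_0 al and b = v + eps_0 be
    with i_0 u = i_0 v = 0; the cocycle condition says D u = D v = 0.  The defect
    becomes a sum of three terms ([twist_log_wedge]).  Two of them vanish by
    parity, or because a one-form u as above is a multiple of eps_1, or because
    D kills the forms of degree zero and of top degree; the third one is a multiple of eps_1 eps_0
    and is exact ([exact_cross]).  So [twist t] induces an isomorphism of
    cohomology algebras ([chain_iso_cohomology]). *)

Set Implicit Arguments.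
Unset Strict Implicit.
Unset Printing Implicit Defensive.

Import GRing.Theory.
Local Open Scope ring_scope.

(** * Exterior calculus *)

Section Exterior.
Variables (K : fieldType) (L : lmodType K).
Local Notation form := (seq L -> K^o).
Local Notation one := (@form1 K L).
Implicit Types (a b c w e f : form) (s : seq L) (x y : L).

Lemma grinv_linear k a b : grinv (k *: a + b) = k *: grinv a + grinv b.
Proof. by apply/funext => s; rewrite !formE /grinv !formE mulrDr mulrCA. Qed.

Lemma grinv0 : grinv (0 : form) = 0.
Proof. by apply/funext => s; rewrite /grinv mulr0. Qed.

Lemma grinvD a b : grinv (a + b) = grinv a + grinv b.
Proof. by rewrite -[a in LHS]scale1r grinv_linear scale1r. Qed.

Lemma grinvB a b : grinv (a - b) = grinv a - grinv b.
Proof. by rewrite addrC -scaleN1r grinv_linear scaleN1r addrC. Qed.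

Lemma grinv_wedge a b : grinv (wedge a b) = wedge (grinv a) (grinv b).
Proof.
apply/funext => s; elim: s a b => [|x s IHs] a b.
  by rewrite /grinv !wedge_nil /= !expr0 !mul1r.
rewrite -[LHS]/(contr x (grinv _) s) contr_grinv contr_wedge wedge_cons.
rewrite -[(- _) s]/(- (grinv _ s)) -[wedge (contr x a) b]scale1r grinv_linear.
rewrite scale1r !contr_grinv wedgeNl wedgeNr !formE !IHs.
by rewrite opprD.
Qed.

(** The wedge is a shuffle product, so that its laws do not require alternating
    arguments: they follow by induction from the Leibniz rule for contractions. *)
Lemma wedgeA a b c : wedge a (wedge b c) = wedge (wedge a b) c.
Proof.
apply/funext => s; elim: s a b c => [|x s IHs] a b c.
  by rewrite !wedge_nil mulrA.
rewrite !wedge_cons !contr_wedge wedgeDl wedgeDr !formE !IHs grinv_wedge.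
by rewrite addrA.
Qed.

Lemma contrD x y w : multilinear w -> contr (x + y) w = contr x w + contr y w.
Proof. by move=> mw; rewrite -[x]scale1r contr_linear// !scale1r. Qed.

Lemma contr0 w : multilinear w -> contr 0 w = 0.
Proof. by move=> mw; apply/funext => s; apply: (multilinear0 [::] s mw). Qed.

Lemma contrZ k x w : multilinear w -> contr (k *: x) w = k *: contr x w.
Proof. by move=> mw; rewrite -[k *: x]addr0 contr_linear// contr0// addr0. Qed.

Lemma contr_form1 x : contr x one = 0.
Proof. by apply/funext. Qed.

Lemma grinv_form1 : grinv one = one.
Proof.
by apply/funext => -[|x s]; rewrite /grinv /form1 ?expr0 ?mul1r//= mulr0.
Qed.

Lemma wedge1l a : wedge one a = a.
Proof.
apply/funext => s; elim: s a => [|x s IHs] a; first by rewrite wedge_nil mul1r.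
by rewrite wedge_cons contr_form1 wedge0l grinv_form1 !formE IHs add0r.
Qed.

Lemma wedge1r a : wedge a one = a.
Proof.
apply/funext => s; elim: s a => [|x s IHs] a; first by rewrite wedge_nil mulr1.
by rewrite wedge_cons contr_form1 wedge0r !formE IHs addr0.
Qed.

Lemma homogeneous0 a : homogeneous 0 a -> a = a [::] *: one.
Proof.
move=> ha; apply/funext => -[|x s]; first by rewrite formE /form1 /= mulr1.
by rewrite ha// formE /form1 mulr0.
Qed.

Lemma homogeneous_contr k x a : homogeneous k.+1 a -> homogeneous k (contr x a).
Proof. by move=> ha s ns; apply: ha. Qed.

Lemma grinv_homogeneous k a : homogeneous k a -> grinv a = (-1) ^+ k *: a.
Proof.
move=> ha; apply/funext => s; rewrite !formE /grinv.
by have [->//|/ha->] := eqVneq (size s) k; rewrite !mulr0.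
Qed.

Lemma is_form_grinv k a : is_form k a -> is_form k (grinv a).
Proof.
by move=> fa; have [h _ _] := fa; rewrite (grinv_homogeneous h); apply: is_formZ.
Qed.

Lemma contr1_wedge e x a : homogeneous 1 e ->
  contr x (wedge e a) = e [:: x] *: a - wedge e (contr x a).
Proof.
move=> he; rewrite contr_wedge (grinv_homogeneous he) expr1 scaleN1r wedgeNl.
by rewrite (homogeneous0 (homogeneous_contr x he)) wedgeZl wedge1l.
Qed.

Lemma wedge1C e a : homogeneous 1 e -> wedge e a = wedge (grinv a) e.
Proof.
move=> he; apply/funext => s; elim: s a => [|x s IHs] a.
  by rewrite !wedge_nil he// mul0r mulr0.
rewrite -[LHS]/(contr x _ s) contr1_wedge// wedge_cons contr_grinv wedgeNl grinvK.
rewrite (homogeneous0 (homogeneous_contr x he)) wedgeZr wedge1r !formE IHs.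
by rewrite addrC.
Qed.

Lemma wedge1_anti e f a : homogeneous 1 e -> homogeneous 1 f ->
  wedge e (wedge f a) = - wedge f (wedge e a).
Proof.
move=> he hf; rewrite !wedgeA (wedge1C f he) (grinv_homogeneous hf) expr1.
by rewrite scaleN1r !wedgeNl.
Qed.

Lemma wedge1_sqr e a : homogeneous 1 e -> wedge e (wedge e a) = 0.
Proof.
move=> he; rewrite wedgeA -[RHS](wedge0l a); congr (wedge _ a).
apply/funext => -[|x s]; first by rewrite wedge_nil he// mul0r.
rewrite -[LHS]/(contr x _ s) contr1_wedge//.
by rewrite (homogeneous0 (homogeneous_contr x he)) wedgeZr wedge1r !formE subrr.
Qed.

End Exterior.

Lemma lie_der_homogeneous (K : fieldType) (g : lieAlgType K) k (x : g)
    (w : seq g -> K^o) :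
  homogeneous k w -> homogeneous k (lie_der x w).
Proof.
move=> hw s ns; rewrite /lie_der big1// => j _; rewrite hw ?mulr0//=.
by rewrite size_del// prednK// (leq_ltn_trans _ (ltn_ord j)).
Qed.

(** * Cohomology of isomorphic cochain complexes *)

Definition chain_map (K : fieldType) (g h : lieAlgType K)
    (Phi : (seq g -> K^o) -> (seq h -> K^o)) : Prop :=
  [/\ linear Phi,
      forall k w, is_form k w -> is_form k (Phi w) &
      forall k w, is_form k w -> ce_diff (Phi w) = Phi (ce_diff w)].

Section ChainMap.
Variables (K : fieldType) (g h : lieAlgType K).
Variable Phi : (seq g -> K^o) -> (seq h -> K^o).
Hypothesis cPhi : chain_map Phi.

Lemma chain_map_linear c a b : Phi (c *: a + b) = c *: Phi a + Phi b.
Proof. by have [lP _ _] := cPhi; rewrite lP. Qed.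

Lemma chain_map0 : Phi 0 = 0.
Proof.
have := chain_map_linear (-1) 0 0.
by rewrite scaler0 addr0 scaleN1r addNr.
Qed.

Lemma chain_mapB a b : Phi (a - b) = Phi a - Phi b.
Proof. by rewrite addrC -scaleN1r chain_map_linear scaleN1r addrC. Qed.

Lemma chain_map_cocycle k w : w \in cocycle k -> Phi w \in cocycle k.
Proof.
have [_ fP dP] := cPhi; move=> /cocycleP[hw dw]; apply/cocycleP.
by split; [apply: fP | rewrite (dP k)// dw chain_map0].
Qed.

Lemma chain_map_coboundary k w : w \in coboundary k -> Phi w \in coboundary k.
Proof.
have [_ fP dP] := cPhi.
case: k => [|k] /coboundaryP => [/= ->|[a ha ->]]; first by rewrite chain_map0 rpred0.
by apply/coboundaryP; exists (Phi a); [apply: fP | rewrite (dP k)].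
Qed.

Definition cohom_map k (x : cohomology g k) : cohomology h k :=
  cohom_class k (Phi (rep x)).

Lemma cohom_map_class k a : a \in cocycle k ->
  cohom_map (cohom_class k a) = cohom_class k (Phi a).
Proof.
move=> ha; apply/eqP; rewrite cls_eq ?chain_map_cocycle ?rep_mem//.
by rewrite -chain_mapB chain_map_coboundary ?rep_cls.
Qed.

Fact cohom_map_linear k : linear (@cohom_map k).
Proof.
move=> c x y; have [hx hy] := (rep_mem x, rep_mem y).
rewrite -[in LHS](repK x) -[in LHS](repK y) -cls_linear// cohom_map_class.
  rewrite chain_map_linear /cohom_class cls_linear//; exact: chain_map_cocycle.
by rewrite rpredD ?rpredZ.
Qed.

End ChainMap.

(** The maps are not required to respect the wedge product of forms: a product of
    cocycles only has to be preserved up to coboundaries, so the Lie algebras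
    themselves need not be isomorphic. *)
Lemma chain_iso_cohomology (K : fieldType) (g h : lieAlgType K)
    (Phi : (seq g -> K^o) -> (seq h -> K^o))
    (Psi : (seq h -> K^o) -> (seq g -> K^o)) :
  chain_map Phi -> chain_map Psi ->
  (forall k w, is_form k w -> Psi (Phi w) = w) ->
  (forall k w, is_form k w -> Phi (Psi w) = w) ->
  Phi (@form1 K g) = @form1 K h ->
  (forall p q a b, a \in cocycle p -> b \in cocycle q ->
    Phi (wedge a b) - wedge (Phi a) (Phi b) \in coboundary (p + q)) ->
  cohomology_isomorphic g h.
Proof.
move=> cPhi cPsi PhiK PsiK Phi1 PhiM.
have zP k (x : cohomology g k) : is_form k (rep x).
  by have /cocycleP[] := rep_mem x.
have zQ k (x : cohomology h k) : is_form k (rep x).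
  by have /cocycleP[] := rep_mem x.
pose f k : {linear cohomology g k -> cohomology h k} := HB.pack
  (@cohom_map K g h Phi k)
  (GRing.isLinear.Build K _ _ *:%R _ (cohom_map_linear cPhi (k := k))).
exists f; split=> [k||p q x y].
- exists (@cohom_map K h g Psi k) => x.
    rewrite -[LHS]/(cohom_map Psi (cohom_class k (Phi (rep x)))).
    rewrite (cohom_map_class cPsi) ?(chain_map_cocycle cPhi) ?rep_mem//.
    by rewrite (PhiK k)//; apply: repK.
  rewrite -[LHS]/(cohom_map Phi (cohom_class k (Psi (rep x)))).
  rewrite (cohom_map_class cPhi) ?(chain_map_cocycle cPsi) ?rep_mem//.
  by rewrite (PsiK k)//; apply: repK.
- rewrite -[LHS]/(cohom_map Phi (cohom_class 0 (@form1 K g))).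
  by rewrite (cohom_map_class cPhi) ?cocycle1// Phi1.
- have [hx hy] := (rep_mem x, rep_mem y).
  rewrite -[LHS]/(cohom_map Phi (cohom_class _ (wedge (rep x) (rep y)))).
  rewrite (cohom_map_class cPhi) ?cocycle_wedge//.
  rewrite -[RHS]/(cup (cohom_class p (Phi (rep x))) (cohom_class q (Phi (rep y)))).
  rewrite cup_class ?(chain_map_cocycle cPhi)//.
  apply/eqP; rewrite cls_eq ?(chain_map_cocycle cPhi) ?cocycle_wedge ?PhiM//.
  + exact: (chain_map_cocycle cPhi).
  + exact: (chain_map_cocycle cPhi).
Qed.

(** * Carnot algebras of filtered isomorphisms *)

Section CarnotFunctor.
Variables (K : fieldType) (g h : finLieAlgType K) (phi : {linear g -> h}).
Hypothesis dim_gh : \dim {:g} = \dim {:h}.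
Hypothesis phi_lcs : forall i x, x \in lcs g i -> phi x \in lcs h i.
(* The graded bracket lives in degree [(i + j).+1], so that this says that [phi]
   is a Lie algebra morphism up to terms of higher filtration degree. *)
Hypothesis phi_lie : forall i j x y, x \in lcs g i -> y \in lcs g j ->
  phi (lie x y) - lie (phi x) (phi y) \in lcs h (i + j).+2.

Definition carnot_map (x : carnot g) : carnot h :=
  [ffun i : 'I_(\dim {:h}) => cls (lcs h i) (lcs h i.+1)
     (phi (rep (x (cast_ord (esym dim_gh) i))))].

Fact carnot_map_linear : linear carnot_map.
Proof.
move=> c x y; apply/dsumP => i; rewrite dsumDE dsumZE !ffunE.
rewrite -cls_linear ?phi_lcs ?rep_mem//; apply/eqP.
rewrite cls_eq; first last.
- by apply: rpredD; rewrite ?rpredZ// phi_lcs ?rep_mem.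
- by rewrite phi_lcs ?rep_mem.
rewrite -linearZZ -raddfD -raddfB phi_lcs//.
have := crep_linear c x y (cast_ord (esym dim_gh) i).
by rewrite /crep dsumDE dsumZE; apply.
Qed.

(** Brackets of classes are computed on representatives, and the representative
    [phi (crep x i)] of the class of [carnot_map x] is as good as the one chosen
    by [crep]. *)
Lemma carnot_map_lie x y :
  carnot_map (lie x y) = lie (carnot_map x) (carnot_map y).
Proof.
pose u i := phi (crep x (cast_ord (esym dim_gh) i)).
pose v i := phi (crep y (cast_ord (esym dim_gh) i)).
have gu i : u i \in lcs h i by apply: phi_lcs; apply: rep_mem.
have gv i : v i \in lcs h i by apply: phi_lcs; apply: rep_mem.
have Eu i : crep (carnot_map x) i - u i \in lcs h i.+1.
  by rewrite /crep ffunE; apply/rep_cls/phi_lcs/rep_mem.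
have Ev i : crep (carnot_map y) i - v i \in lcs h i.+1.
  by rewrite /crep ffunE; apply/rep_cls/phi_lcs/rep_mem.
apply/dsumP => k; rewrite -[RHS]/(carnot_lie (carnot_map x) (carnot_map y) k).
rewrite (@carnot_lieE _ _ _ _ _ (fun k : 'I__ => graded_lie u v k)); first last.
- move=> i; rewrite -(subrKA (graded_lie u (crep (carnot_map y)) i)) rpredD//.
    by apply: graded_lie_eql => //; apply: crep_graded.
  by apply: graded_lie_eqr.
- exact: graded_lie_graded.
set k' := cast_ord (esym dim_gh) k.
rewrite ffunE -/k'; apply/eqP; rewrite cls_eq; first last.
- exact: graded_lie_graded.
- by apply: phi_lcs; apply: rep_mem.
rewrite -(subrKA (phi (graded_lie (crep x) (crep y) k'))) rpredD//.
  by rewrite -raddfB phi_lcs//; apply: (crep_lie x y k').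
have cast_bij : bijective (cast_ord (esym dim_gh)).
  by exists (cast_ord dim_gh); [apply: cast_ordKV | apply: cast_ordK].
rewrite raddf_sum /graded_lie (reindex _ (onW_bij _ cast_bij)) /=.
rewrite -sumrB rpred_sum// => i _.
rewrite raddf_sum (reindex _ (onW_bij _ cast_bij)) /=.
rewrite -sumrB rpred_sum// => j /eqP <-.
by apply: phi_lie; apply: rep_mem.
Qed.

End CarnotFunctor.

(** A linear isomorphism compatible with the lower central series need not be a
    morphism of Lie algebras to induce an isomorphism of Carnot algebras: a defect
    that lies one step deeper than the bracket is invisible in the graded pieces. *)
Lemma carnot_isomorphic (K : fieldType) (g h : finLieAlgType K)
    (phi : {linear g -> h}) (psi : {linear h -> g}) :
  cancel phi psi -> cancel psi phi ->
  (forall i x, x \in lcs g i -> phi x \in lcs h i) ->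
  (forall i x, x \in lcs h i -> psi x \in lcs g i) ->
  (forall i j x y, x \in lcs g i -> y \in lcs g j ->
    phi (lie x y) - lie (phi x) (phi y) \in lcs h (i + j).+2) ->
  lie_isomorphic (carnot g) (carnot h).
Proof.
move=> phiK psiK phi_lcs psi_lcs phi_lie.
have dimP (V W : vectType K) (f : {linear V -> W}) (f' : {linear W -> V}) :
    cancel f f' -> (\dim {:V} <= \dim {:W})%N.
  move=> fK; have inj : lker (linfun f) == 0%VS.
    by apply/lker0P => x y; rewrite !lfunE; apply: can_inj fK _ _.
  by rewrite -(limg_dim_eq (f := linfun f) (U := {:V})) ?dimvS ?subvf// (eqP inj) capv0.
have dim_gh : \dim {:g} = \dim {:h}.
  by apply/eqP; rewrite eqn_leq (dimP _ _ _ _ phiK) (dimP _ _ _ _ psiK).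
pose F : {linear carnot g -> carnot h} := HB.pack (carnot_map phi dim_gh)
  (GRing.isLinear.Build K _ _ *:%R _ (carnot_map_linear dim_gh phi_lcs)).
exists F; split; last exact: carnot_map_lie.
have mapK (g1 h1 : finLieAlgType K) (f : {linear g1 -> h1}) (f' : {linear h1 -> g1})
    (E : \dim {:g1} = \dim {:h1}) (E' : \dim {:h1} = \dim {:g1}) :
    cancel f f' -> (forall i x, x \in lcs g1 i -> f x \in lcs h1 i) ->
    (forall i x, x \in lcs h1 i -> f' x \in lcs g1 i) ->
    cancel (carnot_map f E) (carnot_map f' E').
  move=> fK f_lcs f'_lcs x; apply/dsumP => i; rewrite !ffunE.
  have -> : cast_ord (esym E) (cast_ord (esym E') i) = i by apply: val_inj.
  rewrite -[RHS]repK; apply/eqP; rewrite cls_eq ?rep_mem//; last first.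
    by apply: f'_lcs; apply: rep_mem.
  rewrite -[X in _ - X](fK (rep (x i))) -raddfB f'_lcs//.
  by apply: rep_cls; apply: f_lcs; apply: rep_mem.
exists (carnot_map psi (esym dim_gh)); exact: mapK.
Qed.

(** * The filiform algebras *)

Section Coordinates.
Variable K : fieldType.
Local Notation V := 'rV[K]_5.
Implicit Types (x y : V) (s : seq K).

Definition crd (j : nat) (x : V) : K := x 0 (inord j).
Definition vec (s : seq K) : V := \row_(j < 5) s`_j.
Definition bas (j : nat) : V := vec (ncons j 0 [:: 1]).

Lemma crd_vec s j : (j < 5)%N -> crd j (vec s) = s`_j.
Proof. by move=> j5; rewrite /crd mxE inordK. Qed.

Lemma crdP x y : (forall j, (j < 5)%N -> crd j x = crd j y) -> x = y.
Proof.
move=> E; apply/rowP => j; have := E j (ltn_ord j).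
by rewrite /crd inord_val.
Qed.

Lemma crdP5 x y : crd 0 x = crd 0 y -> crd 1 x = crd 1 y -> crd 2 x = crd 2 y ->
  crd 3 x = crd 3 y -> crd 4 x = crd 4 y -> x = y.
Proof. by move=> *; apply: crdP => -[|[|[|[|[|[]]]]]]. Qed.

Fact crd_linear j : linear (crd j : V -> K^o).
Proof. by move=> c x y; rewrite /crd !mxE. Qed.
HB.instance Definition _ j :=
  GRing.isLinear.Build K V K^o *:%R (crd j) (crd_linear j).

Lemma crdD j x y : crd j (x + y) = crd j x + crd j y.
Proof. by rewrite /crd !mxE. Qed.
Lemma crdZ j c x : crd j (c *: x) = c * crd j x.
Proof. by rewrite /crd !mxE. Qed.
Lemma crd0 j : crd j (0 : V) = 0.
Proof. by rewrite /crd !mxE. Qed.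

Lemma vec_bas x : x = crd 0 x *: bas 0 + (crd 1 x *: bas 1 + (crd 2 x *: bas 2 +
  (crd 3 x *: bas 3 + (crd 4 x *: bas 4)))).
Proof. by apply: crdP5; rewrite !crdD !crdZ !crd_vec//=; ring. Qed.

Definition crdE := (crdD, crdZ, crd0, @crd_vec).

End Coordinates.

(** The parameter only enters through the Lie bracket; it appears in the type so
    that each value of it carries its own Lie algebra structure. *)
Definition filiform (K : fieldType) (t : K) : Type := 'rV[K]_5.

Section Filiform.
Variables (K : fieldType) (t : K).

HB.instance Definition _ := Vector.copy (filiform t) 'rV[K]_5.

Definition filiform_lie (x y : filiform t) : filiform t :=
  vec [:: 0; 0; crd 0 x * crd 1 y - crd 1 x * crd 0 y;
       crd 0 x * crd 2 y - crd 2 x * crd 0 y;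
       crd 0 x * crd 3 y - crd 3 x * crd 0 y +
         t * (crd 1 x * crd 2 y - crd 2 x * crd 1 y)].

Fact filiform_lie_linearl z : linear (filiform_lie^~ z).
Proof. by move=> c x y; apply: crdP5; rewrite !crdE//=; ring. Qed.
Fact filiform_lie_linearr z : linear (filiform_lie z).
Proof. by move=> c x y; apply: crdP5; rewrite !crdE//=; ring. Qed.
Fact filiform_liexx x : filiform_lie x x = 0.
Proof. by apply: crdP5; rewrite !crdE//=; ring. Qed.
Fact filiform_lie_jacobi x y z :
  filiform_lie x (filiform_lie y z) + filiform_lie y (filiform_lie z x) +
  filiform_lie z (filiform_lie x y) = 0.
Proof. by apply: crdP5; rewrite !crdE//= ?crdE//=; ring. Qed.

HB.instance Definition _ := Lmodule_isLie.Build K (filiform t)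
  filiform_lie_linearl filiform_lie_linearr filiform_liexx filiform_lie_jacobi.

Lemma lie_bas0 j : (0 < j < 4)%N -> lie (bas K 0 : filiform t) (bas K j) = bas K j.+1.
Proof.
by case: j => [|[|[|[|]]]]// _; apply: crdP5; rewrite !crdE//= ?crdE//=; ring.
Qed.

Lemma bas_lcs i j : (i < j < 5)%N -> (bas K j : filiform t) \in lcs (filiform t) i.
Proof.
elim: i j => [|i IHi] j; first by rewrite memvf.
case: j => [//|j] ij.
rewrite -lie_bas0; last by lia.
by rewrite lie_antisym rpredN mem_lie_span ?memvf// IHi; lia.
Qed.

(** The answer does not depend on [t], which is why the identity map is compatible
    with the lower central series of all members of the family. *)
Lemma mem_lcs i (x : filiform t) : x \in lcs (filiform t) i.+1 <->
  forall j, (j < i.+2)%N -> (j < 5)%N -> crd j x = 0.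
Proof.
split=> [|x0].
  elim: i x => [|i IHi] x xi j ji j5.
    suff /subvP/(_ _ xi) : (lcs (filiform t) 1 <=
        lker (linfun (crd j : {linear filiform t -> K^o})))%VS.
      by rewrite memv_ker lfunE => /eqP.
    apply/lie_spanP => u v _ _; rewrite memv_ker lfunE /= crd_vec//.
    by case: j ji j5 => [|[|]].
  suff /subvP/(_ _ xi) : (lcs (filiform t) i.+2 <=
      lker (linfun (crd j : {linear filiform t -> K^o})))%VS.
    by rewrite memv_ker lfunE => /eqP.
  apply/lie_spanP => u v /IHi u0 _; rewrite memv_ker lfunE /= crd_vec//.
  case: j ji j5 => [|[|[|[|[|]]]]]//= ji j5; rewrite !u0//; try lia.
  - by rewrite !mul0r subrr.
  - by rewrite !mul0r subrr.
  - by rewrite !mul0r !subrr mulr0 addr0.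
rewrite (vec_bas x); have H j : (j < 5)%N ->
    crd j x *: bas K j \in lcs (filiform t) i.+1.
  move=> j5; have [ji|ji] := ltnP j i.+2; first by rewrite x0// scale0r rpred0.
  by rewrite rpredZ// bas_lcs// ji.
by rewrite !rpredD// H.
Qed.

Lemma filiform_nilpotent : nilpotent_lie (filiform t).
Proof.
exists 4; apply/eqP; rewrite -subv0; apply/subvP => x /mem_lcs x0.
by rewrite memv0; apply/eqP/crdP => j j5; rewrite x0 ?crd0//; lia.
Qed.

End Filiform.

(** The brackets of [filiform s] and [filiform t] differ by a multiple of e4, with
    a factor which vanishes as soon as the degrees of the arguments sum to at
    least two; and in degrees summing to at most one e4 is deep enough. *)
Lemma filiform_carnot (K : fieldType) (s t : K) :
  lie_isomorphic (carnot (filiform s)) (carnot (filiform t)).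
Proof.
pose I (a b : K) : {linear filiform a -> filiform b} :=
  (idfun : {linear 'rV[K]_5 -> 'rV[K]_5}).
have lcsI a b i (x : filiform a) : x \in lcs (filiform a) i ->
    I a b x \in lcs (filiform b) i.
  by case: i => [|i]; [rewrite !memvf | move=> /mem_lcs H; apply/mem_lcs].
apply: (carnot_isomorphic (phi := I s t) (psi := I t s) _ _ (@lcsI s t) (@lcsI t s)) => //.
move=> i j x y xi yj.
apply/mem_lcs => k ki k5.
have x0 l : (0 < i)%N -> (l < i.+1)%N -> (l < 5)%N -> crd l x = 0.
  by case: (i) xi => // i' /mem_lcs H _; apply: H.
have y0 l : (0 < j)%N -> (l < j.+1)%N -> (l < 5)%N -> crd l y = 0.
  by case: (j) yj => // j' /mem_lcs H _; apply: H.
have -> : I s t (lie x y) - lie (I s t x) (I s t y) =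
    ((s - t) * (crd 1 x * crd 2 y - crd 2 x * crd 1 y)) *: bas K 4.
  by apply: crdP5; rewrite crdD -scaleN1r !crdZ !crd_vec//=; ring.
rewrite crdZ crd_vec//.
have [kj|] := ltnP k 4; first by move: k kj {ki k5} => [|[|[|[|]]]]//=; rewrite mulr0.
move=> k4; case: (posnP i) => [i0|i_gt0].
  by rewrite (y0 1%N) ?(y0 2%N)//; try lia; rewrite !mulr0 subrr mulr0 mul0r.
case: (posnP j) => [j0|j_gt0].
  by rewrite (x0 1%N) ?(x0 2%N)//; try lia; rewrite !mul0r subrr mulr0 mul0r.
by rewrite (x0 1%N)// (y0 1%N)// mul0r mulr0 subrr mulr0 mul0r.
Qed.

(** Let X and Y be the images of e0 and e1, and d = X0 Y1 - X1 Y0.  In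
    [filiform t] the coordinate of [Y,[X,Y]] on e3 is Y0 d and [X,[X,[X,Y]]] is
    X0^2 d e4.  Hence d <> 0 and Y0 = 0, and then the coordinate of
    [Y,[X,Y]] on e4 is t Y1 d, which forces Y1 = 0 and d = 0. *)
Lemma filiform_not_isomorphic (K : fieldType) (t : K) : t != 0 ->
  ~ lie_isomorphic (filiform 0) (filiform t).
Proof.
move=> t0 [f [fbij flie]].
pose X := f (bas K 0); pose Y := f (bas K 1).
have XY : lie Y (lie X Y) = 0.
  rewrite /X /Y -!flie -[RHS](raddf0 f); congr (f _).
  by apply: crdP5; rewrite !crdE//= ?crdE//=; ring.
have XXXY : lie X (lie X (lie X Y)) != 0.
  rewrite /X /Y -!flie !lie_bas0// -(raddf0 f) (inj_eq (bij_inj fbij)).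
  by apply/eqP => /(congr1 (crd 4)) /eqP; rewrite crd_vec// crd0 oner_eq0.
pose d := crd 0 X * crd 1 Y - crd 1 X * crd 0 Y.
have Y0d : crd 0 Y * d = 0.
  by have := congr1 (crd 3) XY; rewrite !crdE//= ?crdE//= mulr0 subr0.
have X0d : crd 0 X * d != 0.
  apply: contra XXXY => /eqP X0d; apply/eqP.
  have Z2 : crd 0 X * crd 2 (lie X Y) = 0 by rewrite crd_vec//=.
  have [Z0 Z1] : crd 0 (lie X Y) = 0 /\ crd 1 (lie X Y) = 0 by rewrite !crd_vec.
  move: (lie X Y) Z0 Z1 Z2 => Z Z0 Z1 Z2.
  by apply: crdP5; rewrite !crdE//= ?crdE//= ?Z0 ?Z1 ?Z2; ring.
have d0 : d != 0 by apply: contraNneq X0d => ->; rewrite mulr0.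
have Y0 : crd 0 Y = 0.
  by apply/eqP; have /eqP := Y0d; rewrite mulf_eq0 (negPf d0) orbF.
have : t * crd 1 Y * d = 0.
  have := congr1 (crd 4) XY; rewrite !crdE//= ?crdE//= Y0.
  by rewrite /d Y0; move=> E; rewrite -[RHS]E; ring.
move=> /eqP; rewrite !mulf_eq0 (negPf t0) (negPf d0) orbF /= => /eqP Y1.
by move: d0; rewrite /d Y0 Y1 !mulr0 subrr eqxx.
Qed.

(** * The differential of the filiform algebras *)

Section FiliformForms.
Variable K : fieldType.
Local Notation V := 'rV[K]_5.
Local Notation form := (seq V -> K^o).
Local Notation bas := (bas K).
Implicit Types (c t : K) (a b w u v al be : form) (x y : V) (s : seq V).
Implicit Types (i j k n p q : nat).

Definition cov j : form := fun s => if s is [:: x] then crd j x else 0.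
Local Notation ext j := (wedge (cov j)).
Local Notation ins j := (contr (bas j)).

Lemma cov_form j : is_form 1 (cov j).
Proof.
split=> [[|x [|y s]]//|s t c u v|s t r u]; rewrite /cov.
  by case: s => [|x [|y s]]; case: t => [|z t]; rewrite /= ?mulr0 ?addr0 ?crdD ?crdZ.
by case: s => [|x [|y s]]; case: t => [|z t].
Qed.

Lemma contr_ext x j w : contr x (ext j w) = crd j x *: w - ext j (contr x w).
Proof. by have [h _ _] := cov_form j; rewrite contr1_wedge. Qed.

Lemma ext_anti i j w : ext i (ext j w) = - ext j (ext i w).
Proof. by have [hi _ _] := cov_form i; have [hj _ _] := cov_form j; apply: wedge1_anti. Qed.

Lemma ext_sqr i w : ext i (ext i w) = 0.
Proof. by have [hi _ _] := cov_form i; apply: wedge1_sqr. Qed.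

Lemma ext_linear i c a b : ext i (c *: a + b) = c *: ext i a + ext i b.
Proof. by rewrite wedgeDr wedgeZr. Qed.

Lemma altform_ext j w : altform w -> altform (ext j w).
Proof. by apply: wedge_altform; apply: is_form_altform (cov_form j). Qed.

Lemma is_form_ext j k w : is_form k w -> is_form k.+1 (ext j w).
Proof. exact: is_form_wedge (cov_form j). Qed.

Lemma is_form_contr x k w : is_form k.+1 w -> is_form k (contr x w).
Proof.
move=> fw; have [m a] := altform_contr x (is_form_altform fw).
by have [h _ _] := fw; split=> // s ns; apply: h.
Qed.

Lemma contr_form0 x w : is_form 0 w -> contr x w = 0.
Proof. by move=> [h _ _]; apply/funext => s; apply: h. Qed.

(** The operators [shift] and [D] are the adjoint action of e0 and the Lie
    derivative along e0.  They are the same for all [filiform t], as the parameter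
    only affects brackets of e1 and e2. *)
Definition shift x : V := @filiform_lie K 0 (bas 0) x.
Definition D w : form := @lie_der K (filiform (0 : K)) (bas 0) w.

Lemma D_linear c a b : D (c *: a + b) = c *: D a + D b.
Proof. exact: (@lie_der_linear K (filiform (0 : K))). Qed.
Lemma D0 : D 0 = 0.
Proof. exact: (@lie_der0 K (filiform (0 : K))). Qed.
Lemma DD a b : D (a + b) = D a + D b.
Proof. exact: (@lie_derD K (filiform (0 : K))). Qed.
Lemma DN a : D (- a) = - D a.
Proof. exact: (@lie_derN K (filiform (0 : K))). Qed.
Lemma DB a b : D (a - b) = D a - D b.
Proof. exact: (@lie_derB K (filiform (0 : K))). Qed.
Lemma DZ c a : D (c *: a) = c *: D a.
Proof. by rewrite -[_ *: a]addr0 D_linear D0 addr0. Qed.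
Lemma D_grinv w : D (grinv w) = grinv (D w).
Proof. exact: (@lie_der_grinv K (filiform (0 : K))). Qed.
Lemma D_nil w : D w [::] = 0.
Proof. exact: (@lie_der_nil K (filiform (0 : K))). Qed.
Lemma D_wedge a b : altform a -> altform b ->
  D (wedge a b) = wedge (D a) b + wedge a (D b).
Proof. exact: (@lie_der_wedge K (filiform (0 : K))). Qed.
Lemma contr_D x w : altform w -> contr x (D w) = D (contr x w) - contr (shift x) w.
Proof. exact: (@contr_lie_der K (filiform (0 : K))). Qed.
Lemma altform_D w : altform w -> altform (D w).
Proof. exact: (@altform_lie_der K (filiform (0 : K))). Qed.

Lemma D_homogeneous k w : homogeneous k w -> homogeneous k (D w).
Proof. exact: (@lie_der_homogeneous K (filiform (0 : K))). Qed.

Lemma is_form_D k w : is_form k w -> is_form k (D w).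
Proof.
move=> fw; have [m a] := altform_D (is_form_altform fw).
by have [h _ _] := fw; split=> //; apply: D_homogeneous.
Qed.

Lemma D_form0 w : is_form 0 w -> D w = 0.
Proof.
move=> fw; have fD := is_form_D fw; apply/funext => -[|x s]; first exact: D_nil.
by have [h _ _] := fD; rewrite h.
Qed.

Lemma crd_shift j x : (j < 5)%N ->
  crd j (shift x) = [:: 0; 0; crd 1 x; crd 2 x; crd 3 x]`_j.
Proof.
by move=> j5; rewrite crd_vec//; move: j j5 => [|[|[|[|[|]]]]]//= _; rewrite !crd_vec//=; ring.
Qed.

Lemma D_cov01 j : (j < 2)%N -> D (cov j) = 0.
Proof.
have aj := is_form_altform (cov_form j).
move=> j2; apply/funext => -[|x s]; first exact: D_nil.
rewrite -[LHS]/(contr x (D _) s) contr_D// D_form0; last exact/is_form_contr/cov_form.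
case: s => [|y s]; rewrite !formE sub0r /contr /=; last by rewrite oppr0.
by rewrite crd_shift//; last lia; move: j j2 {aj} => [|[|]]// _; rewrite oppr0.
Qed.

Lemma D_covS j : (0 < j < 4)%N -> D (cov j.+1) = - cov j.
Proof.
have aj := is_form_altform (cov_form j.+1).
move=> j2; apply/funext => -[|x s]; first by rewrite D_nil /cov !formE oppr0.
rewrite -[LHS]/(contr x (D _) s) contr_D// D_form0; last exact/is_form_contr/cov_form.
case: s => [|y s]; rewrite !formE sub0r /contr //=.
by rewrite crd_shift; [move: j j2 {aj} => [|[|[|[|]]]] | lia].
Qed.

Lemma D_ext01 j w : (j < 2)%N -> altform w -> D (ext j w) = ext j (D w).
Proof.
move=> j2 hw; rewrite D_wedge//; last exact: is_form_altform (cov_form j).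
by rewrite D_cov01// wedge0l add0r.
Qed.

Lemma D_extS j w : (0 < j < 4)%N -> altform w ->
  D (ext j.+1 w) = ext j.+1 (D w) - ext j w.
Proof.
move=> j2 hw; rewrite D_wedge//; last exact: is_form_altform (cov_form j.+1).
by rewrite D_covS// wedgeNl addrC.
Qed.

Lemma contr0_D w : altform w -> ins 0 (D w) = D (ins 0 w).
Proof.
move=> hw; rewrite contr_D//.
have -> : shift (bas 0) = 0 by apply: (@filiform_liexx K 0).
by rewrite contr0 ?subr0//; case: hw.
Qed.

Lemma ext_nil j w : ext j w [::] = 0.
Proof. by rewrite wedge_nil mul0r. Qed.

Lemma ext_cons j x a s :
  ext j a (x :: s) = crd j x * a s - ext j (contr x a) s.
Proof. by rewrite -[LHS]/(contr x _ s) contr_ext. Qed.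

Lemma D_cons x a s : altform a ->
  D a (x :: s) = D (contr x a) s - a (shift x :: s).
Proof. by move=> ha; rewrite -[LHS]/(contr x _ s) contr_D. Qed.

Lemma contr_formB x a b : contr x (a - b) = contr x a - contr x b.
Proof. by []. Qed.
Lemma contr_formD x a b : contr x (a + b) = contr x a + contr x b.
Proof. by []. Qed.
Lemma contr_formZ x c a : contr x (c *: a) = c *: contr x a.
Proof. by []. Qed.

(** The bracket of [filiform t] is
    [x,y] = x0 [e0,y] - y0 [e0,x] + t (x1 y2 - x2 y1) e4, and each of its three
    terms contributes one term to the Lie derivative. *)
Lemma lie_derE (t : K) (x : filiform t) w : altform w ->
  lie_der x w = crd 0 x *: D w + ext 0 (contr (shift x) w) -
    t *: (crd 1 x *: ext 2 (ins 4 w) - crd 2 x *: ext 1 (ins 4 w)) :> form.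
Proof.
move=> hw; apply/funext => s; elim: s w hw => [|y s IHs] w hw.
  by rewrite lie_der_nil !formE D_nil !ext_nil; ring.
have [mw _] := hw.
have lieE : lie x y = crd 0 x *: shift y + ((- crd 0 y) *: shift x +
    (t * (crd 1 x * crd 2 y - crd 2 x * crd 1 y)) *: bas 4) :> V.
  by apply: crdP5; rewrite !crdD !crdZ !crd_vec//= ?crd_vec//=; ring.
rewrite -[RHS]/(contr y _ s) contr_formB contr_formD !contr_formZ contr_formB !contr_formZ.
rewrite contr_D// !contr_ext !(contrC y)// !wedgeNr.
rewrite -[LHS]/(contr (y : filiform t) (lie_der x w) s) contr_lie_der// !formE.
rewrite [lie_der _ _ _](IHs (contr y w)); last exact: altform_contr.
have -> : contr (lie x y) w s = (crd 0 x *: contr (shift y) w +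
   ((- crd 0 y) *: contr (shift x) w +
    (t * (crd 1 x * crd 2 y - crd 2 x * crd 1 y)) *: ins 4 w)) s.
  by rewrite -!contrZ// -!contrD// -lieE.
rewrite !formE.
move: (D _ s) (ext 0 _ s) (ext 2 _ s) (ext 1 _ s) => *; ring.
Qed.

Lemma ce_diffE (t : K) w : altform w ->
  @ce_diff K (filiform t) w = ext 0 (D w) - t *: ext 1 (ext 2 (ins 4 w)).
Proof.
move=> hw; apply/funext => s; elim: s w hw => [|x s IHs] w hw.
  by rewrite ce_diff_nil !formE !ext_nil; ring.
rewrite -[RHS]/(contr x _ s) contr_formB !contr_formZ !contr_ext contr_D//.
rewrite (contrC x)// !wedgeBr !wedgeNr !wedgeZr.
rewrite -[LHS]/(contr (x : filiform t) (@ce_diff K (filiform t) w) s).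
rewrite contr_ce_diff// !formE [ce_diff _ _](IHs (contr x w)); last exact: altform_contr.
rewrite [lie_der x w](lie_derE x hw).
rewrite !formE.
move: (D _ s) (ext 0 _ s) (ext 0 _ s) (ext 2 _ s) (ext 1 _ s) (ext 1 _ s) => *; ring.
Qed.

(** * The twist is an isomorphism of complexes *)

Lemma ins_ext i j w : (i < 5)%N -> (j < 5)%N ->
  ins i (ext j w) = (i == j)%:R *: w - ext j (ins i w).
Proof.
move=> i5 j5; rewrite contr_ext; congr (_ *: _ - _); rewrite crd_vec//.
by move: i j i5 j5 => [|[|[|[|[|]]]]]// [|[|[|[|[|]]]]].
Qed.

Lemma shift_bas i : (i < 5)%N -> shift (bas i) = if (0 < i < 4)%N then bas i.+1 else 0.
Proof.
move=> i5; apply: crdP => j j5; rewrite crd_shift// !crd_vec//.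
by move: i j i5 j5 => [|[|[|[|[|]]]]]// [|[|[|[|[|]]]]]//= _ _; rewrite ?crd_vec// crd0.
Qed.

(** Induction on the number of basis vectors whose contraction is known to kill
    the form: [ins n v] satisfies the hypotheses with one more vector, so it
    vanishes, and then so does [v]. *)
Lemma altform_basis0 w : altform w ->
  (forall ms, size ms = 5 -> w (mask ms [seq bas j | j <- iota 0 5]) = 0) -> w = 0.
Proof.
suff H k n v : (n + k = 5)%N -> altform v -> (forall j, (j < n)%N -> ins j v = 0) ->
    (forall ms, size ms = k -> v (mask ms [seq bas j | j <- iota n k]) = 0) -> v = 0.
  by move=> hw w0; apply: (H 5 0).
elim: k n v => [|k IHk] n v nk hv v0 vm.
  apply/funext => -[|x s]; first exact: (vm [::]).
  have [mv _] := hv; rewrite -[LHS]/(contr x v s) (vec_bas x).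
  by rewrite !contrD// !contrZ// !v0 ?scaler0 ?addr0//; lia.
have insn : ins n v = 0.
  apply: (IHk n.+1) => [||j|ms sz]; [lia | exact: altform_contr | |].
    rewrite ltnS leq_eqVlt => /orP[/eqP ->|jn]; first exact: contr2.
    by rewrite contrC// v0// ; apply/funext => s; rewrite !formE /contr oppr0.
  by rewrite -(vm (true :: ms)) //= sz.
apply: (IHk n.+1) => // [|j|ms sz]; first lia.
  by rewrite ltnS leq_eqVlt => /orP[/eqP ->|/v0].
by rewrite -(vm (false :: ms)) //= sz.
Qed.

Lemma is_form_gt5 k w : (5 < k)%N -> is_form k w -> w = 0.
Proof.
move=> k5 [hw mw aw]; apply: altform_basis0 => // ms ms5; apply: hw.
have := count_size id ms; rewrite size_mask ?size_map ?size_iota// ms5.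
by case: eqP => // ->; lia.
Qed.

(** After multiplication by eps_1 only the values without e1 matter. *)
Lemma ext1_basis0 w : altform w ->
  (forall m0 m2 m3 m4, w (mask [:: m0; m2; m3; m4] [:: bas 0; bas 2; bas 3; bas 4]) = 0) ->
  ext 1 w = 0.
Proof.
move=> hw w0; apply: altform_basis0; first exact: altform_ext.
move=> [|m0[|m1[|m2[|m3[|m4[|]]]]]]// _.
have {w0} := w0 m0 m2 m3 m4.
move: m0 m1 m2 m3 m4 => [] [] [] [] [];
  rewrite /= ?ext_cons ?crd_vec//= ?ext_nil /contr => w0; rewrite ?w0; ring.
Qed.

(** On e2, e3, e4 minus the transpose of D is the shift e2 -> e3 -> e4 -> 0.  In
    degree one the square of D is eps_2 i_4.  In degree two D D = - eps_2 i_4: the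
    derivation extending the square of the shift contributes eps_2 i_4, and the
    cross terms contribute its double with the opposite sign.  In degree three
    both sides vanish. *)
Lemma D_sqr w m2 m3 m4 : altform w ->
  (ext 2 (ins 4 w) + grinv (D (D w))) (mask [:: m2; m3; m4] [:: bas 2; bas 3; bas 4]) = 0.
Proof.
move=> hw; have [mw aw] := hw.
have DDE x v s : altform v -> D (D v) (x :: s) =
    D (D (contr x v)) s - D (contr (shift x) v) s - D v (shift x :: s).
  by move=> hv; rewrite D_cons ?contr_D ?DB//; apply: altform_D.
have [h2 h3] := (shift_bas (i := 2) isT, shift_bas (i := 3) isT).
have h4 := shift_bas (i := 4) isT.
rewrite /= in h2 h3 h4.
have h0 : shift 0 = 0 :> V by apply: (lie0r (bas 0 : filiform (0 : K))).
have gE a s : grinv a s = (-1) ^+ size s * a s by [].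
have z0 s : w (0 :: s) = 0 by apply: (multilinear0 [::] s mw).
have z1 x s : w [:: x, 0 & s] = 0 by apply: (multilinear0 [:: x] s mw).
have z2 x y s : w [:: x, y, 0 & s] = 0 by apply: (multilinear0 [:: x; y] s mw).
have a0 x s : w [:: x, x & s] = 0 by apply: (aw [::] [::]).
have a1 x y s : w [:: x, y, y & s] = 0 by apply: (aw [:: x] [::]).
have s0 x y s : w [:: x, y & s] = - w [:: y, x & s] by apply: altform_swap.
move: m2 m3 m4 => [] [] []; rewrite /= !formE gE ?ext_cons ?ext_nil ?crd_vec//= ?(mul0r,mul1r).
all: rewrite ?(DDE,D_cons,h0,h2,h3,h4,D_nil); try by (do ?apply: altform_contr).
all: by rewrite /contr ?(z0,z1,z2,a0,a1,s0 (bas 4)); ring.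
Qed.

(** This is the obstruction to [twist t] being a cochain map.  Contraction with
    e0 turns the factor of eps_1 into the expression of [D_sqr] for [ins 0 w], and
    on lists without e0 that factor is the expression of [D_sqr] for [w]. *)
Lemma twist_defect w : altform w ->
  ext 1 (ext 2 (ins 4 w) + grinv (D (D w)) +
    2%:R *: ext 0 (grinv (D (D (ins 0 w))))) = 0.
Proof.
move=> hw; apply: ext1_basis0.
  by apply: altformD; [apply: altformD|apply: altformZ];
   repeat first [exact: hw | apply: altform_ext | apply: altform_grinv
                | apply: altform_D | apply: altform_contr].
move=> [] m2 m3 m4.
  rewrite -[RHS](D_sqr m2 m3 m4 (altform_contr (bas 0) hw)).
  rewrite [mask _ _]/= -[LHS]/(ins 0 _ _) !contr_formD contr_formZ !ins_ext//=.
  rewrite contr_grinv contr0_D; last exact: altform_D.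
  rewrite contr0_D// [ins 0 (ins 4 w)]contrC// wedgeNr.
  have -> : ins 0 (grinv (D (D (ins 0 w)))) = 0.
    have h0 := altform_contr (bas 0) hw.
    rewrite contr_grinv contr0_D; last exact: altform_D.
    by rewrite contr0_D// contr2// !D0; apply/funext => s; rewrite !formE /grinv mulr0 oppr0.
  by rewrite wedge0r; move: (if m2 then _ else _) => s; rewrite !formE; ring.
rewrite formDE [mask _ _]/= (D_sqr m2 m3 m4 hw) add0r formZE.
by case: m2 m3 m4 => [] [] []; rewrite /= ?ext_cons ?crd_vec//= ext_nil; ring.
Qed.

Lemma grinv_cov j : grinv (cov j) = - cov j.
Proof.
have [h _ _] := cov_form j.
by rewrite (grinv_homogeneous h) expr1 scaleN1r.
Qed.

Lemma grinv_ext j w : grinv (ext j w) = - ext j (grinv w).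
Proof.
by rewrite grinv_wedge grinv_cov wedgeNl.
Qed.

Lemma wedge_ext j a b : wedge a (ext j b) = ext j (wedge (grinv a) b).
Proof.
have [h _ _] := cov_form j.
by rewrite wedgeA [in RHS]wedgeA (wedge1C _ h) grinvK.
Qed.

Lemma ext_wedge j a b : wedge (ext j a) b = ext j (wedge a b).
Proof. by rewrite wedgeA. Qed.

Definition twist_log w : form := ext 1 (grinv (D (ins 0 w))).
Local Notation N := twist_log.
(** The exponential of [t] times [N], as [N] squares to zero. *)
Definition twist t w : form := w + t *: N w.

Lemma twist_log_linear c a b : N (c *: a + b) = c *: N a + N b.
Proof. by rewrite /twist_log contr_formD contr_formZ D_linear grinv_linear ext_linear. Qed.

Lemma is_form_twist_log k w : is_form k w -> is_form k (N w).
Proof.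
case: k => [|k] fw; last exact/is_form_ext/is_form_grinv/is_form_D/is_form_contr.
by rewrite /twist_log contr_form0// D0 grinv0 wedge0r; apply: is_form0.
Qed.

Lemma twist_log_sqr w : altform w -> N (N w) = 0.
Proof.
move=> hw; have hD := altform_grinv (altform_D (altform_contr (bas 0) hw)).
rewrite /twist_log ins_ext// scale0r sub0r DN D_ext01//; last exact: altform_contr.
by rewrite -sub0r grinvB grinv0 sub0r grinv_ext opprK ext_sqr.
Qed.

Lemma twist_linear t : linear (twist t).
Proof.
move=> c a b; rewrite /twist twist_log_linear.
by apply/funext => s; rewrite !formE; ring.
Qed.

Lemma is_form_twist t k w : is_form k w -> is_form k (twist t w).
Proof. by move=> fw; apply: is_formD => //; apply/is_formZ/is_form_twist_log. Qed.

Lemma twistK t w : altform w -> twist (- t) (twist t w) = w.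
Proof.
move=> hw; rewrite /twist; have -> : N (w + t *: N w) = N w.
  by rewrite addrC twist_log_linear twist_log_sqr// scaler0 add0r.
by apply/funext => s; rewrite !formE; ring.
Qed.

Lemma twist_diff t w : altform w ->
  @ce_diff K (filiform t) (twist t w) = twist t (@ce_diff K (filiform (0 : K)) w).
Proof.
move=> hw.
have hi := altform_contr (bas 0) hw.
have hDi := altform_grinv (altform_D hi).
have hN : altform (N w) by apply: altform_ext.
rewrite !ce_diffE//; last by apply/altformD/altformZ.
rewrite scale0r subr0 /twist DD DZ contr_formD contr_formZ.
have -> : ext 1 (ext 2 (ins 4 w + t *: ins 4 (N w))) = ext 1 (ext 2 (ins 4 w)).
  rewrite /twist_log ins_ext// scale0r sub0r wedgeDr wedgeZr wedgeNr ext_anti opprK.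
  by rewrite [ext 1 (_ + _)]wedgeDr wedgeZr ext_sqr scaler0 addr0.
have -> : N (ext 0 (D w)) = ext 1 (grinv (D (D w))) + ext 1 (ext 0 (grinv (D (D (ins 0 w))))).
  rewrite /twist_log ins_ext// scale1r contr0_D// DB D_ext01//; last exact: altform_D.
  by rewrite grinvB grinv_ext opprK wedgeDr.
have -> : D (N w) = ext 1 (grinv (D (D (ins 0 w)))).
  by rewrite /twist_log D_ext01// D_grinv.
have := twist_defect hw; rewrite !wedgeDr !wedgeZr [ext 0 (ext 1 _)]ext_anti => E.
apply/funext => s; have := congr1 (fun w => w s) E; rewrite !formE => Es.
move: Es => /eqP; rewrite addrAC addrC addr_eq0 => /eqP ->.
by ring.
Qed.

(** * Multiplicativity up to exact forms *)

(** The operator D i_0 is of second order, so that N fails to be a derivation by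
    a cross term and by the sign [grinv]; the cross term is the last summand on
    the right, the sign is responsible for the other two. *)
Lemma twist_log_wedge al be u v : altform al -> altform be -> altform u -> altform v ->
  ins 0 al = 0 -> ins 0 be = 0 -> ins 0 u = 0 -> ins 0 v = 0 ->
  D u = 0 -> D v = 0 ->
  N (wedge (u + ext 0 al) (v + ext 0 be)) - wedge (N (u + ext 0 al)) (v + ext 0 be) -
    wedge (u + ext 0 al) (N (v + ext 0 be)) =
  ext 1 (wedge (grinv (D al)) (grinv v - v)) +
  ext 1 (wedge (u - grinv u) (grinv (D be))) -
  ext 1 (ext 0 (wedge (D al) be - wedge (grinv al) (grinv (D be)))).
Proof.
move=> hal hbe hu hv al0 be0 u0 v0 Du Dv.
have NE w' z : ins 0 w' = 0 -> ins 0 z = 0 -> N (w' + ext 0 z) = ext 1 (grinv (D z)).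
  by move=> w0 z0; rewrite /twist_log contr_formD w0 ins_ext// z0 wedge0r subr0 add0r scale1r.
rewrite !NE//.
have -> : N (wedge (u + ext 0 al) (v + ext 0 be)) =
    ext 1 (wedge (grinv (D al)) (grinv v) + wedge u (grinv (D be))).
  rewrite /twist_log contr_wedge contr_formD u0 ins_ext// al0 wedge0r subr0 add0r scale1r.
  rewrite contr_formD v0 ins_ext// be0 wedge0r subr0 add0r scale1r.
  congr (ext 1 _); rewrite wedgeDr wedge_ext.
  have -> : grinv (u + ext 0 al) = grinv u - ext 0 (grinv al).
    by rewrite grinvD grinv_ext.
  rewrite wedgeBl ext_wedge -addrA [ext 0 _ + _]addrC subrK.
  rewrite DD !D_wedge//; last exact: altform_grinv.
  rewrite Dv D_grinv Du grinv0 wedge0r wedge0l addr0 add0r.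
  by rewrite grinvD !grinv_wedge grinvK.
rewrite !(wedgeDr, wedgeDl, wedgeNl, wedgeNr, ext_wedge, wedge_ext, grinv_ext).
rewrite grinvD grinv_ext !grinv_cov !(wedgeDl, wedgeDr, wedgeNl, wedgeNr, ext_wedge).
by rewrite grinvK [ext 1 (ext 0 _)]ext_anti; apply/funext => s; rewrite !formE; ring.
Qed.

(** A form is closed for t = 0 when eps_0 (D a) = 0, that is, when D a is
    eps_0 (D (i_0 a)); equivalently D kills the part of [a] without eps_0. *)
Lemma cocycle_split p a : a \in cocycle (g := filiform (0 : K)) p ->
  [/\ is_form p a, is_form p (a - ext 0 (ins 0 a)), ins 0 (a - ext 0 (ins 0 a)) = 0 &
      D (a - ext 0 (ins 0 a)) = 0].
Proof.
move=> /cocycleP[fa da]; have ha := is_form_altform fa.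
have hia := altform_contr (bas 0) ha.
have Da : D a = ext 0 (D (ins 0 a)).
  move: da; rewrite ce_diffE// scale0r subr0 => /(congr1 (ins 0)).
  by rewrite ins_ext// scale1r contr0_D// => /eqP; rewrite subr_eq0 => /eqP.
split=> //.
- case: p fa => [|p] fa; first by rewrite contr_form0// wedge0r subr0.
  by rewrite -scaleN1r; apply/is_formD/is_formZ/is_form_ext/is_form_contr.
- by rewrite contr_formB ins_ext// scale1r contr2// wedge0r subr0 subrr.
- by rewrite DB D_ext01// Da subrr.
Qed.

(** As the shift maps onto the span of e2, e3, e4, a one-form killed by D
    vanishes on these vectors. *)
Lemma ker_D1 u : is_form 1 u -> ins 0 u = 0 -> D u = 0 -> u = u [:: bas 1] *: cov 1.
Proof.
move=> fu u0 Du; have hu := is_form_altform fu; have [mu _] := hu.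
have us x : u [:: shift x] = 0.
  have := congr1 (fun w : form => w [:: x]) Du.
  rewrite -[LHS]/(contr x (D u) [::]) contr_D// !formE D_nil sub0r.
  by move=> /eqP; rewrite oppr_eq0 => /eqP.
have ub j : (0 < j < 4)%N -> ins j.+1 u = 0.
  move=> j4; have := us (bas j); rewrite shift_bas; last lia.
  move=> ujS; rewrite j4 in ujS.
  have fj : is_form 0 (ins j.+1 u) by apply: is_form_contr.
  by have [h _ _] := fj; rewrite (homogeneous0 h) [_ [::]]ujS scale0r.
have [hh _ _] := fu; have [hc _ _] := cov_form 1.
apply/funext => -[|x s]; first by rewrite hh// formE /cov mulr0.
rewrite -[LHS]/(contr x u s) {1}(vec_bas x) !contrD// !contrZ// u0.
rewrite (ub 1) ?(ub 2) ?(ub 3)// !scaler0 !addr0 add0r.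
case: s => [|y s]; first by rewrite formE /= mulrC.
by rewrite !formE [ins 1 u _]hh// /cov !mulr0.
Qed.

(** The shift is nilpotent, hence of trace zero: every substitution of e_j by
    e_(j+1) in the list e0, ..., e4 creates a repetition. *)
Lemma D_top k w : (4 < k)%N -> is_form k w -> D w = 0.
Proof.
move=> k4 fw; have fD := is_form_D fw.
have [k5|k5] := ltnP 5 k; first exact: is_form_gt5 fD.
have {k4 k5} k5 : k = 5 by lia.
rewrite k5 in fw fD.
have hw := is_form_altform fw; have [mw aw] := hw.
apply: altform_basis0; first exact: is_form_altform fD.
have [hD _ _] := fD.
move=> [|m0[|m1[|m2[|m3[|m4[|]]]]]]// _.
case: m0 m1 m2 m3 m4 => [] [] [] [] []; rewrite [mask _ _]/=; try by apply: hD.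
rewrite !D_cons; try by (do ?apply: altform_contr).
rewrite !shift_bas//= D_nil /contr.
rewrite (multilinear0 [::] _ mw) (multilinear0 [:: _; _; _; _] _ mw).
rewrite (aw [:: bas 0] [::] [:: bas 3; bas 4]) (aw [:: bas 0; bas 1] [::] [:: bas 4]).
by rewrite (aw [:: bas 0; bas 1; bas 2] [::] [::]) !subrr.
Qed.

(** For [q = 1] the form [v] is a multiple of eps_1, and for [m = 0] already D al
    vanishes.  Otherwise the left-hand side is D (eps_1 al v), where the form
    eps_1 al v has degree at least five. *)
Lemma ext1_D_wedge m q al v : odd q -> is_form m al -> is_form q v ->
  ins 0 v = 0 -> D v = 0 -> ext 1 (wedge (D al) v) = 0.
Proof.
move=> oq fal fv v0 Dv.
have [hal hv] := (is_form_altform fal, is_form_altform fv).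
have [q1|q1] := eqVneq q 1.
  rewrite q1 in fv; have -> : v = v [:: bas 1] *: ext 1 (@form1 K V).
    by rewrite wedge1r; apply: ker_D1.
  by rewrite wedgeZr wedge_ext wedgeZr ext_sqr scaler0.
case: m fal => [|m] fal; first by rewrite D_form0// wedge0l wedge0r.
have <- : D (ext 1 (wedge al v)) = ext 1 (wedge (D al) v).
  by rewrite D_ext01 ?D_wedge ?Dv ?wedge0r ?addr0//; apply: wedge_altform.
by apply: (@D_top (m.+1 + q).+1); [lia | apply/is_form_ext/is_form_wedge].
Qed.

Lemma ext1_wedge_D n p u be : odd p -> is_form n be -> is_form p u ->
  ins 0 u = 0 -> D u = 0 -> ext 1 (wedge u (D be)) = 0.
Proof.
move=> op fbe fu u0 Du.
have [hbe hu] := (is_form_altform fbe, is_form_altform fu).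
have [p1|p1] := eqVneq p 1.
  by rewrite p1 in fu; rewrite (ker_D1 fu u0 Du) wedgeZl wedgeZr ext_sqr scaler0.
case: n fbe => [|n] fbe; first by rewrite D_form0// !wedge0r.
have <- : D (ext 1 (wedge u be)) = ext 1 (wedge u (D be)).
  by rewrite D_ext01 ?D_wedge ?Du ?wedge0l ?add0r//; apply: wedge_altform.
by apply: (@D_top (p + n.+1).+1); [lia | apply/is_form_ext/is_form_wedge].
Qed.

Section Exact.
Variable t : K.
Local Notation exact_form := (coboundary (g := filiform t)).

Lemma exact_ext01_D k w : is_form k w -> ext 1 (ext 0 (D w)) \in exact_form k.+2.
Proof.
move=> fw; have hw := is_form_altform fw; apply/coboundaryP.
exists (- ext 1 w); first by rewrite -scaleN1r; apply/is_formZ/is_form_ext.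
rewrite ce_diffN ce_diffE; last exact: altform_ext.
rewrite D_ext01// ins_ext// scale0r sub0r !wedgeNr [ext 1 (ext 2 _)]ext_anti ext_sqr.
by rewrite wedge0r !oppr0 scaler0 subr0 ext_anti.
Qed.

(** Modulo eps_0 and eps_1 the image of D on two-forms is spanned by eps_2 eps_3
    and eps_2 eps_4, so that [exact_ext01_D] does not reach eps_1 eps_0 eps_3 eps_4.
    This form is the differential of eps_2 eps_3 eps_4, as D eps_2 = - eps_1. *)
Lemma exact_ext01_2form w : is_form 2 w -> ext 1 (ext 0 w) \in exact_form 4.
Proof.
move=> fw; have f1 : is_form 0 (@form1 K V) by apply: is_form1.
 set one := (@form1 K V) in f1.
have f2 i j : is_form 2 (ext i (ext j one)) by do 2!apply: is_form_ext.
have f3 i j k : is_form 3 (ext i (ext j (ext k one))) by apply: is_form_ext.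
pose c i j := w [:: bas i; bas j].
pose w' : form := c 3 4 *: ext 3 (ext 4 one) + (c 2 4 *: ext 2 (ext 4 one) +
  c 2 3 *: ext 2 (ext 3 one)).
pose z : form := c 3 4 *: ext 2 (ext 3 (ext 4 one)) +
  (c 2 4 *: ext 1 (ext 3 (ext 4 one)) + c 2 3 *: ext 1 (ext 2 (ext 4 one))).
have fw' : is_form 2 w' by do ?apply: is_formD; apply: is_formZ.
have fz : is_form 3 z by do ?apply: is_formD; apply: is_formZ.
have -> : ext 1 (ext 0 w) = ext 1 (ext 0 w').
  apply/eqP; rewrite -subr_eq0 -wedgeBr -wedgeBr; apply/eqP.
  have fd : is_form 2 (w - w') by rewrite -scaleN1r; apply/is_formD/is_formZ.
  have [hd _ _] := fd.
  apply: ext1_basis0; first exact/altform_ext/is_form_altform/fd.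
  have Eij i j : (1 < i < j)%N -> (j < 5)%N -> (w - w') [:: bas i; bas j] = 0.
    rewrite formDE formNE /w' !formDE !formZE => ij j5.
    have : [|| (i == 2) && (j == 3), (i == 2) && (j == 4) | (i == 3) && (j == 4)]%N.
      by lia.
    case/or3P => /andP[/eqP -> /eqP ->];
      rewrite !ext_cons !ext_nil /contr !ext_cons !ext_nil !crd_vec//= /c /one /form1 /=;
      ring.
  move=> m0 m2 m3 m4.
  case: m0 m2 m3 m4 => [] [] [] []; rewrite /= ?ext_cons ?crd_vec//= ?ext_nil ?Eij ?hd//; ring.
apply/coboundaryP; exists z => //.
rewrite ce_diffE; last exact: is_form_altform fz.
have a1 j : altform (ext j one) by apply: is_form_altform (is_form_ext _ f1).
have a2 i j : altform (ext i (ext j one)) by apply: is_form_altform (f2 _ _).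
have Z1 a : ext 1 (ext 2 (ins 4 (ext 1 a))) = 0.
  by rewrite ins_ext// scale0r sub0r !wedgeNr [ext 2 _]ext_anti wedgeNr ext_sqr !oppr0.
have Z2 a : ext 1 (ext 2 (ins 4 (ext 2 a))) = 0.
  by rewrite ins_ext// scale0r sub0r !wedgeNr ext_sqr wedge0r oppr0.
rewrite !contr_formD !contr_formZ !wedgeDr !wedgeZr Z2 !Z1 !scaler0 !addr0 scaler0 subr0.
have D1 : D one = 0 by apply: D_form0.
have h1 : altform one by apply: is_form_altform f1.
have D34 : D (ext 3 (ext 4 one)) = - ext 2 (ext 4 one).
  by rewrite D_extS// D_extS// D1 wedge0r sub0r wedgeNr ext_sqr oppr0 sub0r.
have D24 : D (ext 2 (ext 4 one)) = - ext 2 (ext 3 one) - ext 1 (ext 4 one).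
  by rewrite D_extS// D_extS// D1 wedge0r sub0r wedgeNr.
have D234 : D (ext 2 (ext 3 (ext 4 one))) = - ext 1 (ext 3 (ext 4 one)).
  by rewrite D_extS// D34 wedgeNr ext_sqr oppr0 sub0r.
rewrite !DD !DZ D234 !(@D_ext01 1)// D34 D24 !(wedgeDr, wedgeZr, wedgeNr) ext_sqr.
rewrite wedge0r oppr0 addr0.
by rewrite -![- ext 0 (ext 1 _)]ext_anti.
Qed.

(** If [al] or [be] has degree zero, then al (D be) is D of something or zero.
    Otherwise the degrees are both one, or their sum is at least four and the
    form has degree at least six. *)
Lemma exact_ext01_wedge_D m n al be : ~~ odd (m + n) -> is_form m al -> is_form n be ->
  ext 1 (ext 0 (wedge al (D be))) \in exact_form (m + n).+2.
Proof.
move=> mn fal fbe; have [hal hbe] := (is_form_altform fal, is_form_altform fbe).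
case: m fal mn => [|m] fal mn.
  have <- : D (wedge al be) = wedge al (D be) by rewrite D_wedge// D_form0// wedge0l add0r.
  exact/exact_ext01_D/is_form_wedge.
case: n fbe mn => [|n] fbe mn; first by rewrite (D_form0 fbe) !wedge0r; apply: rpred0.
have fw := is_form_wedge fal (is_form_D fbe).
have [mn2|mn2] := eqVneq (m.+1 + n.+1)%N 2.
  by rewrite mn2 in fw *; apply: exact_ext01_2form.
rewrite (_ : ext 1 _ = 0); first exact: rpred0.
apply: (@is_form_gt5 (m.+1 + n.+1).+2); last by do 2!apply: is_form_ext.
by move: mn mn2; rewrite addSn addnS => + /eqP; case: (m + n)%N => [|[|]].
Qed.

(** The factor is D (al be) minus 1 + (-1)^(m + n) times al (D be), and the
    correction is present for even [m + n] only. *)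
Lemma exact_cross m n al be : is_form m al -> is_form n be ->
  ext 1 (ext 0 (wedge (D al) be - wedge (grinv al) (grinv (D be)))) \in
    exact_form (m + n).+2.
Proof.
move=> fal fbe; have [hal hbe] := (is_form_altform fal, is_form_altform fbe).
have [h _ _] := is_form_wedge fal (is_form_D fbe).
have -> : wedge (D al) be - wedge (grinv al) (grinv (D be)) =
    D (wedge al be) - (1 + (-1) ^+ (m + n)) *: wedge al (D be).
  rewrite -grinv_wedge (grinv_homogeneous h) D_wedge//.
  by apply/funext => s; rewrite !formE; ring.
rewrite !wedgeBr !wedgeZr; apply: rpredB; first exact/exact_ext01_D/is_form_wedge.
have [omn|emn] := boolP (odd (m + n)); last exact/rpredZ/exact_ext01_wedge_D.
by rewrite -signr_odd omn subrr scale0r; apply: rpred0.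
Qed.

Lemma twist_wedge p q a b :
  a \in cocycle (g := filiform (0 : K)) p -> b \in cocycle (g := filiform (0 : K)) q ->
  twist t (wedge a b) - wedge (twist t a) (twist t b) \in exact_form (p + q).
Proof.
move=> /cocycle_split[fa fu u0 Du] /cocycle_split[fb fv v0 Dv].
have [ha hb] := (is_form_altform fa, is_form_altform fb).
set u := a - _ in fu u0 Du; set v := b - _ in fv v0 Dv.
have Ea : a = u + ext 0 (ins 0 a) by rewrite subrK.
have Eb : b = v + ext 0 (ins 0 b) by rewrite subrK.
have NN : wedge (N a) (N b) = 0 by rewrite /twist_log ext_wedge wedge_ext ext_sqr.
have -> : twist t (wedge a b) - wedge (twist t a) (twist t b) =
    t *: (N (wedge a b) - wedge (N a) b - wedge a (N b)).
  rewrite /twist !(wedgeDl, wedgeDr, wedgeZl, wedgeZr) NN.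
  by apply/funext => s; rewrite !formE; ring.
apply: rpredZ; rewrite Ea Eb twist_log_wedge//; first last.
all: try exact: is_form_altform fu.
all: try exact: is_form_altform fv.
all: try exact: altform_contr.
all: try exact: contr2.
move: fa fb {Ea Eb NN ha hb} => fa fb; clearbody u v.
have -> : ext 1 (wedge (grinv (D (ins 0 a))) (grinv v - v)) = 0.
  case: p fa {fu} => [|m] fa; first by rewrite contr_form0// D0 grinv0 wedge0l wedge0r.
  have fal := is_form_contr (bas 0) fa.
  have [[hv _ _] [hD _ _]] := (fv, is_form_D fal).
  rewrite (grinv_homogeneous hD) wedgeZl (grinv_homogeneous hv) -(signr_odd _ q).
  have [oq|_] := boolP (odd q); last by rewrite scale1r subrr !wedge0r scaler0 wedge0r.
  by rewrite wedgeZr !wedgeBr !wedgeZr (ext1_D_wedge oq fal)// !scaler0 subrr scaler0.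
have -> : ext 1 (wedge (u - grinv u) (grinv (D (ins 0 b)))) = 0.
  case: q fb {fv} => [|n] fb; first by rewrite contr_form0// D0 grinv0 !wedge0r.
  have fbe := is_form_contr (bas 0) fb.
  have [[hu _ _] [hD _ _]] := (fu, is_form_D fbe).
  rewrite (grinv_homogeneous hD) !wedgeZr (grinv_homogeneous hu) -(signr_odd _ p).
  have [op|_] := boolP (odd p); last by rewrite scale1r subrr !wedge0l wedge0r scaler0.
  rewrite !wedgeBl !wedgeBr !wedgeZl !wedgeZr (ext1_wedge_D op fbe)//.
  by rewrite !scaler0 subrr scaler0.
rewrite addr0 sub0r -scaleN1r; apply: rpredZ.
case: p fa {fu} => [|m] fa.
  by rewrite contr_form0// D0 grinv0 !wedge0l subrr !wedge0r; apply: rpred0.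
case: q fb {fv} => [|n] fb.
  by rewrite [ins 0 b]contr_form0// D0 grinv0 !wedge0r subrr !wedge0r; apply: rpred0.
by rewrite addSn addnS; apply: exact_cross; apply: is_form_contr.
Qed.

End Exact.

End FiliformForms.

Lemma twist_form1 (K : fieldType) (t : K) : twist t (form1 (L := 'rV[K]_5)) = @form1 K _.
Proof. by rewrite /twist /twist_log contr_form1 D0 grinv0 wedge0r scaler0 addr0. Qed.

Lemma filiform_cohomology (K : fieldType) (t : K) :
  cohomology_isomorphic (filiform (0 : K)) (filiform t).
Proof.
have untwist k w : is_form k w -> twist t (twist (- t) w) = w.
  by move=> /is_form_altform hw; rewrite -[X in twist X _]opprK twistK.
apply: (@chain_iso_cohomology K (filiform (0 : K)) (filiform t) (@twist K t) (@twist K (- t))).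
- split=> [|k w|k w /is_form_altform]; [exact: twist_linear|exact: is_form_twist|].
  exact: twist_diff.
- split=> [|k w|k w fw]; [exact: twist_linear|exact: is_form_twist|].
  have hw' : altform (twist (- t) w) := is_form_altform (is_form_twist (- t) fw).
  rewrite -[in RHS](untwist k w fw) (twist_diff t hw') twistK//.
  exact: (@altform_ce_diff K (filiform (0 : K))).
- by move=> k w /is_form_altform; apply: twistK.
- exact: untwist.
- exact: twist_form1.
- exact: twist_wedge.
Qed.

Theorem theorem3p1 (R : realType) :
  exists g h : finLieAlgType R,
    [/\ nilpotent_lie g, nilpotent_lie h,
        lie_isomorphic (carnot g) (carnot h),
        cohomology_isomorphic g h &
        ~ lie_isomorphic g h].
Proof.
exists (filiform (0 : R)), (filiform (1 : R)); split.
- exact: filiform_nilpotent.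
- exact: filiform_nilpotent.
- exact: filiform_carnot.
- exact: filiform_cohomology.
- exact/filiform_not_isomorphic/oner_neq0.
Qed.
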